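(* Let $A=(a_{ij})_{i,j=1}^n$ be a symmetrizable generalized Cartan matrix, $\mathfrak{g}(A)$ the associated complex Kac-Moody algebra with Chevalley generators $e_i,f_i$, $\omega$ its Chevalley involution, $\mathfrak{k}(A)=\{x\in\mathfrak{g}(A)\mid \omega(x)=x\}$, $\mathfrak{n}(A)$ the Lie subalgebra of $\mathfrak{g}(A)$ generated by $e_1,\ldots,e_n$, and $\mathcal{L}(A)$ the generalized Onsager algebra with generators $B_1,\ldots,B_n$. Put $Y_i:=e_i-f_i\in\mathfrak{k}(A)$. (a) The assignment $\psi(B_i)=Y_i$ ($i=1,\ldots,n$) defines a Lie algebra homomorphism $\psi:\mathcal{L}(A)\to\mathfrak{k}(A)$, and $\psi$ is an isomorphism. (b) The assignment $\varphi(e_i)=[B_i]_1$ ($i=1,\ldots,n$) defines a graded Lie algebra homomorphism $\varphi:\mathfrak{n}(A)\to\mathrm{Gr}(\mathcal{L}(A))$, and $\varphi$ is an isomorphism.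
   Context: Kac-Moody algebra: let $(\mathfrak{h}(A),\{\alpha_i\}_{i=1}^n,\{h_i\}_{i=1}^n)$ be a realization of $A$, i.e. $\mathfrak{h}(A)$ is a complex vector space of dimension $2n-\mathrm{rk}(A)$, and $\{\alpha_i\}\subset\mathfrak{h}(A)^*$, $\{h_i\}\subset\mathfrak{h}(A)$ are linearly independent with $\alpha_j(h_i)=a_{ij}$. $\mathfrak{g}(A)$ is the complex Lie algebra generated by $\mathfrak{h}(A)$ and $e_i,f_i$ ($1\le i\le n$) with defining relations $[h,h']=0$, $[h,e_j]=\alpha_j(h)e_j$, $[h,f_j]=-\alpha_j(h)f_j$, $[e_i,f_j]=\delta_{i,j}h_i$ for $h,h'\in\mathfrak{h}(A)$, and the Serre relations $(\mathrm{ad}\,e_i)^{1-a_{ij}}e_j=0=(\mathrm{ad}\,f_i)^{1-a_{ij}}f_j$ for $i\neq j$. (For symmetrizable $A$ this is equivalent to the usual definition, by Gabber-Kac.) The Chevalley involution $\omega$ is the involutive automorphism with $\omega|_{\mathfrak{h}(A)}=-\mathrm{Id}$ and $\omega(e_i)=-f_i$. Grading: $\mathfrak{n}(A)$ is graded by giving each $e_i$ degree one; its $k$th graded component is the sum of the root spaces $\mathfrak{g}_\alpha(A)$ over positive roots $\alpha$ of height $k$. By Gabber-Kac, $\mathfrak{n}(A)$ is presented by generators $e_1,\dots,e_n$ and relations $(\mathrm{ad}\,e_i)^{1-a_{ij}}e_j=0$ ($i\ne j$). Integers $c_s^{ij}[r]$ ($1\le i\ne j\le n$, $r\ge s\ge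 0$): $c_r^{ij}[r]:=1$ for $r\ge0$, $c_{r-1}^{ij}[r]:=0$ for $r\ge1$, and for $r\ge2$, $0\le s\le r-2$, $$c_s^{ij}[r]=c_{s-1}^{ij}[r-1]-(r-1)(r-2+a_{ij})\,c_s^{ij}[r-2],$$ with the convention $c_{-1}^{ij}[r]:=0$. Generalized Onsager algebra: $\mathcal{L}(A)$ is the complex Lie algebra with generators $B_1,\ldots,B_n$ and defining relations $$\sum_{s=0}^{1-a_{ij}}c_s^{ij}[1-a_{ij}]\,(\mathrm{ad}\,B_i)^sB_j=0,\qquad 1\le i\neq j\le n.$$ Filtration: for $j\ge1$, $\mathcal{L}_j(A)$ is the linear span of all iterated brackets $[B_{i_1},\ldots[B_{i_{m-2}},[B_{i_{m-1}},B_{i_m}]]\ldots]$ with $1\le i_s\le n$ and $1\le m\le j$ (for $m=1$ this is $B_{i_1}$), and $\mathcal{L}_0(A):=\{0\}$. This makes $\mathcal{L}(A)=\bigcup_{j\ge 1}\mathcal{L}_j(A)$ a filtered Lie algebra. $\mathrm{Gr}(\mathcal{L}(A))=\bigoplus_{j\ge1}\mathcal{L}_j(A)/\mathcal{L}_{j-1}(A)$ is the associated graded Lie algebra, and $[x]_j:=x+\mathcal{L}_{j-1}(A)$ for $x\in\mathcal{L}_j(A)$. *)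

(* Defs.v *)
From HB Require Import structures.
From mathcomp Require Import all_boot all_order all_algebra.
From mathcomp Require Import complex.
From mathcomp Require Import all_classical all_reals.

Set Implicit Arguments.
Unset Strict Implicit.
Unset Printing Implicit Defensive.

Import GRing.Theory.

Local Open Scope ring_scope.
Local Open Scope classical_set_scope.

Reserved Notation "[lie x , y ]" (at level 0, x, y at level 200,
  format "[lie  x ,  y ]").

HB.mixin Record Lmodule_isLieAlg (K : fieldType) L of GRing.Lmodule K L := {
  lieb : L -> L -> L;
  liebDl : forall x y z, lieb (x + y) z = lieb x z + lieb y z;
  liebDr : forall x y z, lieb x (y + z) = lieb x y + lieb x z;
  liebZl : forall a x y, lieb (a *: x) y = a *: lieb x y;
  liebZr : forall a x y, lieb x (a *: y) = a *: lieb x y;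
  liebxx : forall x, lieb x x = 0;
  lieb_jacobi : forall x y z,
    lieb x (lieb y z) + lieb y (lieb z x) + lieb z (lieb x y) = 0
}.

#[short(type="lieAlgType")]
HB.structure Definition LieAlg (K : fieldType) :=
  { L of GRing.Lmodule K L & Lmodule_isLieAlg K L }.

Notation "[lie x , y ]" := (lieb x y) : ring_scope.

Section LieTheory.
Variables (K : fieldType) (L : lieAlgType K).
Implicit Types x y z : L.

Lemma lieb0l y : [lie (0 : L), y] = 0.
Proof. by rewrite -(scale0r (0 : L)) liebZl !scale0r. Qed.

Lemma lieb0r x : [lie x, (0 : L)] = 0.
Proof. by rewrite -(scale0r (0 : L)) liebZr !scale0r. Qed.

Lemma liebNl x y : [lie - x, y] = - [lie x, y].
Proof. by rewrite -scaleN1r liebZl scaleN1r. Qed.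

Lemma liebNr x y : [lie x, - y] = - [lie x, y].
Proof. by rewrite -scaleN1r liebZr scaleN1r. Qed.

Lemma liebBl x y z : [lie x - y, z] = [lie x, z] - [lie y, z].
Proof. by rewrite liebDl liebNl. Qed.

Lemma liebBr x y z : [lie x, y - z] = [lie x, y] - [lie x, z].
Proof. by rewrite liebDr liebNr. Qed.

Lemma liebC x y : [lie x, y] = - [lie y, x].
Proof.
have := liebxx (x + y); rewrite liebDl !liebDr !liebxx addr0 add0r.
by move/eqP; rewrite addr_eq0 => /eqP.
Qed.

Lemma lieb_leibniz x y z :
  [lie [lie x, y], z] = [lie x, [lie y, z]] - [lie y, [lie x, z]].
Proof.
have := lieb_jacobi x y z; rewrite (liebC z [lie x, y]) (liebC z x) liebNr.
by move/eqP; rewrite subr_eq0 => /eqP <-.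
Qed.

Lemma lieb_sumr I (r : seq I) (P : pred I) (F : I -> L) x :
  [lie x, \sum_(i <- r | P i) F i] = \sum_(i <- r | P i) [lie x, F i].
Proof. by elim/big_rec2: _ => [|i u v _ <-]; rewrite ?lieb0r ?liebDr. Qed.

Lemma lieb_suml I (r : seq I) (P : pred I) (F : I -> L) x :
  [lie \sum_(i <- r | P i) F i, x] = \sum_(i <- r | P i) [lie F i, x].
Proof. by elim/big_rec2: _ => [|i u v _ <-]; rewrite ?lieb0l ?liebDl. Qed.

End LieTheory.

Record lie_hom (K : fieldType) (L L' : lieAlgType K) (f : L -> L') : Prop :=
  LieHom {
    lie_hom_linear : linear f;
    lie_hom_lieb : forall x y, f [lie x, y] = [lie f x, f y]
  }.

(* Formal Lie words; the Lie algebra with given generators and relations is     *)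
(* their quotient by the smallest Lie algebra congruence identifying the two    *)
(* sides of every relation.                                                     *)
Inductive lie_term (K : Type) (X : Type) : Type :=
| LGen of X
| LZero
| LAdd of lie_term K X & lie_term K X
| LOpp of lie_term K X
| LScale of K & lie_term K X
| LBr of lie_term K X & lie_term K X.
Arguments LGen {K X}.
Arguments LZero {K X}.

HB.instance Definition _ K X := gen_eqMixin (lie_term K X).
HB.instance Definition _ K X := gen_choiceMixin (lie_term K X).

Section Presentation.
Variables (K : fieldType) (X : Type).
Local Notation term := (lie_term K X).
Variable rel : term -> term -> Prop.

Inductive lie_cong : term -> term -> Prop :=
| LCrel t u : rel t u -> lie_cong t u
| LCrefl t : lie_cong t t
| LCsym t u : lie_cong t u -> lie_cong u t
| LCtrans u t v : lie_cong t u -> lie_cong u v -> lie_cong t v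
| LCadd t t' u u' :
    lie_cong t t' -> lie_cong u u' -> lie_cong (LAdd t u) (LAdd t' u')
| LCopp t t' : lie_cong t t' -> lie_cong (LOpp t) (LOpp t')
| LCscale a t t' : lie_cong t t' -> lie_cong (LScale a t) (LScale a t')
| LCbr t t' u u' :
    lie_cong t t' -> lie_cong u u' -> lie_cong (LBr t u) (LBr t' u')
| LCaddA t u v : lie_cong (LAdd t (LAdd u v)) (LAdd (LAdd t u) v)
| LCaddC t u : lie_cong (LAdd t u) (LAdd u t)
| LCadd0 t : lie_cong (LAdd LZero t) t
| LCaddN t : lie_cong (LAdd (LOpp t) t) LZero
| LCscaleA a b t : lie_cong (LScale a (LScale b t)) (LScale (a * b) t)
| LCscale1 t : lie_cong (LScale 1 t) t
| LCscaleDr a t u :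
    lie_cong (LScale a (LAdd t u)) (LAdd (LScale a t) (LScale a u))
| LCscaleDl a b t :
    lie_cong (LScale (a + b) t) (LAdd (LScale a t) (LScale b t))
| LCbrDl t u v : lie_cong (LBr (LAdd t u) v) (LAdd (LBr t v) (LBr u v))
| LCbrDr t u v : lie_cong (LBr t (LAdd u v)) (LAdd (LBr t u) (LBr t v))
| LCbrZl a t u : lie_cong (LBr (LScale a t) u) (LScale a (LBr t u))
| LCbrZr a t u : lie_cong (LBr t (LScale a u)) (LScale a (LBr t u))
| LCbrxx t : lie_cong (LBr t t) LZero
| LCjacobi t u v :
    lie_cong
      (LAdd (LAdd (LBr t (LBr u v)) (LBr u (LBr v t))) (LBr v (LBr t u)))
      LZero.

Definition lie_congb (t u : term) : bool := `[< lie_cong t u >].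

Lemma lie_congb_refl : reflexive lie_congb.
Proof. by move=> t; apply/asboolP; exact: LCrefl. Qed.

Lemma lie_congb_sym : symmetric lie_congb.
Proof.
by move=> t u; apply/idP/idP => /asboolP ?; apply/asboolP; exact: LCsym.
Qed.

Lemma lie_congb_trans : transitive lie_congb.
Proof.
by move=> u t v /asboolP ? /asboolP ?; apply/asboolP; apply: (@LCtrans u).
Qed.

Definition lie_cong_equiv :=
  EquivRel lie_congb lie_congb_refl lie_congb_sym lie_congb_trans.

Definition lie_pres : Type := {eq_quot lie_cong_equiv}%qT.

HB.instance Definition _ := Choice.on lie_pres.

Definition pres_pi (t : term) : lie_pres := (\pi_({eq_quot lie_cong_equiv}) t)%qT.
Definition pres_repr (x : lie_pres) : term :=
  repr (x : {eq_quot lie_cong_equiv}%qT).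

Lemma pres_piE t u : pres_pi t = pres_pi u <-> lie_cong t u.
Proof.
split=> [/eqquotP/asboolP //|h].
by apply/eqquotP/asboolP.
Qed.

Lemma pres_reprK x : pres_pi (pres_repr x) = x.
Proof. exact: reprK. Qed.

Lemma pres_ind (P : lie_pres -> Prop) :
  (forall t, P (pres_pi t)) -> forall x, P x.
Proof. by move=> h x; rewrite -(pres_reprK x). Qed.

Lemma pres_cong t : lie_cong (pres_repr (pres_pi t)) t.
Proof. by apply/pres_piE; rewrite pres_reprK. Qed.

Definition pres_zero : lie_pres := pres_pi LZero.
Definition pres_opp (x : lie_pres) := pres_pi (LOpp (pres_repr x)).
Definition pres_add (x y : lie_pres) :=
  pres_pi (LAdd (pres_repr x) (pres_repr y)).
Definition pres_scale a (x : lie_pres) := pres_pi (LScale a (pres_repr x)).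
Definition pres_br (x y : lie_pres) :=
  pres_pi (LBr (pres_repr x) (pres_repr y)).

Lemma pres_oppE t : pres_opp (pres_pi t) = pres_pi (LOpp t).
Proof. by apply/pres_piE/LCopp/pres_cong. Qed.
Lemma pres_addE t u : pres_add (pres_pi t) (pres_pi u) = pres_pi (LAdd t u).
Proof. by apply/pres_piE/LCadd; exact: pres_cong. Qed.
Lemma pres_scaleE a t : pres_scale a (pres_pi t) = pres_pi (LScale a t).
Proof. by apply/pres_piE/LCscale/pres_cong. Qed.
Lemma pres_brE t u : pres_br (pres_pi t) (pres_pi u) = pres_pi (LBr t u).
Proof. by apply/pres_piE/LCbr; exact: pres_cong. Qed.

Let presE := (pres_oppE, pres_addE, pres_scaleE, pres_brE).

Lemma pres_addrA : associative pres_add.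
Proof.
elim/pres_ind=> t; elim/pres_ind=> u; elim/pres_ind=> v.
by rewrite !presE; apply/pres_piE/LCaddA.
Qed.

Lemma pres_addrC : commutative pres_add.
Proof.
elim/pres_ind=> t; elim/pres_ind=> u.
by rewrite !presE; apply/pres_piE/LCaddC.
Qed.

Lemma pres_add0r : left_id pres_zero pres_add.
Proof. by elim/pres_ind=> t; rewrite !presE; apply/pres_piE/LCadd0. Qed.

Lemma pres_addNr : left_inverse pres_zero pres_opp pres_add.
Proof. by elim/pres_ind=> t; rewrite !presE; apply/pres_piE/LCaddN. Qed.

HB.instance Definition _ := GRing.isZmodule.Build lie_pres
  pres_addrA pres_addrC pres_add0r pres_addNr.

Lemma pres_scalerA a b x :
  pres_scale a (pres_scale b x) = pres_scale (a * b) x.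
Proof.
by elim/pres_ind: x => t; rewrite !presE; apply/pres_piE/LCscaleA.
Qed.

Lemma pres_scale1r : left_id 1 pres_scale.
Proof. by elim/pres_ind=> t; rewrite !presE; apply/pres_piE/LCscale1. Qed.

Lemma pres_scalerDr : right_distributive pres_scale +%R.
Proof.
move=> a; elim/pres_ind=> t; elim/pres_ind=> u.
by rewrite /GRing.add /= !presE; apply/pres_piE/LCscaleDr.
Qed.

Lemma pres_scalerDl x : {morph pres_scale^~ x : a b / a + b}.
Proof.
move=> a b; elim/pres_ind: x => t.
by rewrite [in RHS]/GRing.add /= !presE; apply/pres_piE/LCscaleDl.
Qed.

HB.instance Definition _ := GRing.Zmodule_isLmodule.Build K lie_pres
  pres_scalerA pres_scale1r pres_scalerDr pres_scalerDl.

Lemma pres_piD t u : pres_pi (LAdd t u) = pres_pi t + pres_pi u.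
Proof. by rewrite -pres_addE. Qed.
Lemma pres_piN t : pres_pi (LOpp t) = - pres_pi t.
Proof. by rewrite -pres_oppE. Qed.
Lemma pres_piZ a t : pres_pi (LScale a t) = a *: pres_pi t.
Proof. by rewrite -pres_scaleE. Qed.
Lemma pres_pi0 : pres_pi LZero = 0.
Proof. by []. Qed.

Lemma pres_brDl x y z : pres_br (x + y) z = pres_br x z + pres_br y z.
Proof.
elim/pres_ind: x => t; elim/pres_ind: y => u; elim/pres_ind: z => v.
by rewrite -pres_piD !presE -pres_piD; apply/pres_piE/LCbrDl.
Qed.

Lemma pres_brDr x y z : pres_br x (y + z) = pres_br x y + pres_br x z.
Proof.
elim/pres_ind: x => t; elim/pres_ind: y => u; elim/pres_ind: z => v.
by rewrite -pres_piD !presE -pres_piD; apply/pres_piE/LCbrDr.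
Qed.

Lemma pres_brZl a x y : pres_br (a *: x) y = a *: pres_br x y.
Proof.
elim/pres_ind: x => t; elim/pres_ind: y => u.
by rewrite -pres_piZ !presE -pres_piZ; apply/pres_piE/LCbrZl.
Qed.

Lemma pres_brZr a x y : pres_br x (a *: y) = a *: pres_br x y.
Proof.
elim/pres_ind: x => t; elim/pres_ind: y => u.
by rewrite -pres_piZ !presE -pres_piZ; apply/pres_piE/LCbrZr.
Qed.

Lemma pres_brxx x : pres_br x x = 0.
Proof. by elim/pres_ind: x => t; rewrite !presE; apply/pres_piE/LCbrxx. Qed.

Lemma pres_br_jacobi x y z :
  pres_br x (pres_br y z) + pres_br y (pres_br z x) + pres_br z (pres_br x y)
  = 0.
Proof.
elim/pres_ind: x => t; elim/pres_ind: y => u; elim/pres_ind: z => v.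
by rewrite !presE -!pres_piD; apply/pres_piE/LCjacobi.
Qed.

HB.instance Definition _ := Lmodule_isLieAlg.Build K lie_pres
  pres_brDl pres_brDr pres_brZl pres_brZr pres_brxx pres_br_jacobi.

Lemma pres_piB t u : pres_pi (LBr t u) = [lie pres_pi t, pres_pi u].
Proof. by rewrite -pres_brE. Qed.

Definition pres_gen (x : X) : lie_pres := pres_pi (LGen x).

Section Lift.
Variables (L : lieAlgType K) (f : X -> L).

Fixpoint lie_eval (t : term) : L :=
  match t with
  | LGen x => f x
  | LZero => 0
  | LAdd t u => lie_eval t + lie_eval u
  | LOpp t => - lie_eval t
  | LScale a t => a *: lie_eval t
  | LBr t u => [lie lie_eval t, lie_eval u]
  end.

Lemma lie_eval_cong :
  (forall t u, rel t u -> lie_eval t = lie_eval u) ->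
  forall t u, lie_cong t u -> lie_eval t = lie_eval u.
Proof.
move=> frel t u; elim=> {t u} /=; first exact: frel.
- by [].
- by move=> *.
- by move=> u t v _ -> _ ->.
- by move=> t t' u u' _ -> _ ->.
- by move=> t t' _ ->.
- by move=> a t t' _ ->.
- by move=> t t' u u' _ -> _ ->.
- by move=> *; rewrite addrA.
- by move=> *; rewrite addrC.
- by move=> *; rewrite add0r.
- by move=> *; rewrite addNr.
- by move=> *; rewrite scalerA.
- by move=> *; rewrite scale1r.
- by move=> *; rewrite scalerDr.
- by move=> *; rewrite scalerDl.
- by move=> *; rewrite liebDl.
- by move=> *; rewrite liebDr.
- by move=> *; rewrite liebZl.
- by move=> *; rewrite liebZr.
- by move=> *; rewrite liebxx.
- by move=> *; rewrite lieb_jacobi.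
Qed.

Definition pres_lift (x : lie_pres) : L := lie_eval (pres_repr x).

Hypothesis frel : forall t u, rel t u -> lie_eval t = lie_eval u.

Lemma pres_liftE t : pres_lift (pres_pi t) = lie_eval t.
Proof. exact/(lie_eval_cong frel)/pres_cong. Qed.

Lemma pres_lift_hom : lie_hom pres_lift.
Proof.
split=> [a|]; elim/pres_ind=> t; elim/pres_ind=> u.
- by rewrite -pres_piZ -pres_piD !pres_liftE.
- by rewrite -pres_piB !pres_liftE.
Qed.

Lemma pres_lift_gen x : pres_lift (pres_gen x) = f x.
Proof. by rewrite pres_liftE. Qed.

Lemma pres_lift_unique g :
  lie_hom g -> (forall x, g (pres_gen x) = f x) -> g =1 pres_lift.
Proof.
move=> [glin gbr] gX; elim/pres_ind=> t; rewrite pres_liftE.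
have g0 : g 0 = 0.
  by have := glin (-1) 0 0; rewrite scaler0 addr0 scaleN1r addNr.
elim: t => //= [t IHt u IHu|t IHt|a t IHt|t IHt u IHu].
- by rewrite pres_piD -[pres_pi t]scale1r glin scale1r IHt IHu.
- by rewrite pres_piN -scaleN1r -[_ *: _]addr0 glin g0 addr0 scaleN1r IHt.
- by rewrite pres_piZ -[_ *: _]addr0 glin g0 addr0 IHt.
- by rewrite pres_piB gbr IHt IHu.
Qed.

End Lift.

End Presentation.

Record submod (K : fieldType) (V : lmodType K) := Submod {
  submod_set :> V -> Prop;
  submod0 : submod_set 0;
  submodD : forall x y, submod_set x -> submod_set y -> submod_set (x + y);
  submodZ : forall a x, submod_set x -> submod_set (a *: x)
}.

Section SubmodTheory.
Variables (K : fieldType) (V : lmodType K) (W : submod V).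

Lemma submodN x : W x -> W (- x).
Proof. by rewrite -scaleN1r; exact: submodZ. Qed.

Lemma submodB x y : W x -> W y -> W (x - y).
Proof. by move=> *; apply: submodD => //; exact: submodN. Qed.

Lemma submod_sum I (r : seq I) (P : pred I) (F : I -> V) :
  (forall i, P i -> W (F i)) -> W (\sum_(i <- r | P i) F i).
Proof. by move=> ?; apply: big_ind => //; [exact: submod0|exact: submodD]. Qed.

End SubmodTheory.

Section Span.
Variables (K : fieldType) (V : lmodType K) (S : set V).

Inductive lspan : V -> Prop :=
| lspan_gen x : S x -> lspan x
| lspan0 : lspan 0
| lspanD x y : lspan x -> lspan y -> lspan (x + y)
| lspanZ a x : lspan x -> lspan (a *: x).

Definition lspan_submod : submod V := Submod lspan0 lspanD lspanZ.

End Span.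

Record lie_subalg (K : fieldType) (L : lieAlgType K) := LieSubalg {
  subalg_submod :> submod L;
  subalg_lieb : forall x y,
    subalg_submod x -> subalg_submod y -> subalg_submod [lie x, y]
}.

Section SubalgType.
Variables (K : fieldType) (L : lieAlgType K) (S : lie_subalg L).

Definition subalg_pred : pred L := fun x => `[< S x >].

Record subalg_type : Type := SubalgElt {
  subalg_val : L;
  subalg_valP : subalg_pred subalg_val
}.

HB.instance Definition _ := [isSub for subalg_val].
HB.instance Definition _ := [Choice of subalg_type by <:].

Lemma subalg_closed : GRing.subsemimod_closed subalg_pred.
Proof.
split; first split.
- by apply/asboolP; exact: submod0.
- by move=> x y /asboolP ? /asboolP ?; apply/asboolP; exact: submodD.
- by move=> a x /asboolP ?; apply/asboolP; exact: submodZ.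
Qed.

HB.instance Definition _ :=
  GRing.SubChoice_isSubLmodule.Build K L subalg_pred subalg_type subalg_closed.

Lemma subalg_val_inj : injective subalg_val.
Proof. exact: (@val_inj _ _ subalg_type). Qed.

Lemma subalg_valD (x y : subalg_type) :
  subalg_val (x + y) = subalg_val x + subalg_val y.
Proof. exact: (raddfD (val : subalg_type -> L)). Qed.

Lemma subalg_valZ a (x : subalg_type) :
  subalg_val (a *: x) = a *: subalg_val x.
Proof. exact: (linearZ_LR (val : subalg_type -> L)). Qed.

Lemma subalg_val0 : subalg_val 0 = 0.
Proof. exact: (raddf0 (val : subalg_type -> L)). Qed.

Lemma subalg_br_subproof (x y : subalg_type) :
  subalg_pred [lie subalg_val x, subalg_val y].
Proof.
by apply/asboolP; apply: subalg_lieb; apply/asboolP; exact: subalg_valP.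
Qed.

Definition subalg_br (x y : subalg_type) := SubalgElt (subalg_br_subproof x y).

Lemma subalg_val_br (x y : subalg_type) :
  subalg_val (subalg_br x y) = [lie subalg_val x, subalg_val y].
Proof. by []. Qed.

Let subalg_valE := (subalg_valD, subalg_valZ, subalg_val0, subalg_val_br).

Fact subalg_brDl x y z : subalg_br (x + y) z = subalg_br x z + subalg_br y z.
Proof. by apply: subalg_val_inj; rewrite !subalg_valE liebDl. Qed.
Fact subalg_brDr x y z : subalg_br x (y + z) = subalg_br x y + subalg_br x z.
Proof. by apply: subalg_val_inj; rewrite !subalg_valE liebDr. Qed.
Fact subalg_brZl a x y : subalg_br (a *: x) y = a *: subalg_br x y.
Proof. by apply: subalg_val_inj; rewrite !subalg_valE liebZl. Qed.
Fact subalg_brZr a x y : subalg_br x (a *: y) = a *: subalg_br x y.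
Proof. by apply: subalg_val_inj; rewrite !subalg_valE liebZr. Qed.
Fact subalg_brxx x : subalg_br x x = 0.
Proof. by apply: subalg_val_inj; rewrite !subalg_valE liebxx. Qed.
Fact subalg_br_jacobi x y z :
  subalg_br x (subalg_br y z) + subalg_br y (subalg_br z x)
  + subalg_br z (subalg_br x y) = 0.
Proof.
by apply: subalg_val_inj; rewrite !subalg_valE lieb_jacobi.
Qed.

HB.instance Definition _ := Lmodule_isLieAlg.Build K subalg_type
  subalg_brDl subalg_brDr subalg_brZl subalg_brZr subalg_brxx subalg_br_jacobi.

Definition subalg_elt (x : L) (Sx : S x) : subalg_type :=
  SubalgElt (asboolT Sx : subalg_pred x).

End SubalgType.

Section Subalgebras.
Variables (K : fieldType) (L : lieAlgType K).

Section Fixed.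
Variables (f : L -> L) (hf : lie_hom f).

Let fixed_set : set L := [set x | f x = x].

Fact fixed_set0 : fixed_set 0.
Proof.
by have := lie_hom_linear hf (-1) 0 0; rewrite scaler0 addr0 scaleN1r addNr.
Qed.
Fact fixed_setD x y : fixed_set x -> fixed_set y -> fixed_set (x + y).
Proof.
rewrite /fixed_set /= => fx fy.
by rewrite -[x in LHS]scale1r (lie_hom_linear hf) scale1r fx fy.
Qed.
Fact fixed_setZ a x : fixed_set x -> fixed_set (a *: x).
Proof.
rewrite /fixed_set /= => fx.
by rewrite -[a *: x in LHS]addr0 (lie_hom_linear hf) fx fixed_set0 addr0.
Qed.
Fact fixed_set_lieb x y : fixed_set x -> fixed_set y -> fixed_set [lie x, y].
Proof. by rewrite /fixed_set /= (lie_hom_lieb hf) => -> ->. Qed.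

Definition fixed_subalg : lie_subalg L :=
  @LieSubalg K L (Submod fixed_set0 fixed_setD fixed_setZ) fixed_set_lieb.

End Fixed.

Section Generated.
Variable S : set L.

Inductive lie_generated : L -> Prop :=
| lie_gen_gen x : S x -> lie_generated x
| lie_gen0 : lie_generated 0
| lie_genD x y : lie_generated x -> lie_generated y -> lie_generated (x + y)
| lie_genZ a x : lie_generated x -> lie_generated (a *: x)
| lie_genB x y :
    lie_generated x -> lie_generated y -> lie_generated [lie x, y].

Definition generated_subalg : lie_subalg L :=
  @LieSubalg K L (Submod lie_gen0 lie_genD lie_genZ) lie_genB.

End Generated.

End Subalgebras.

Section QuotMod.
Variables (K : fieldType) (V : lmodType K) (W : submod V).

Definition quotmod_rel (x y : V) : bool := `[< W (x - y) >].

Lemma quotmod_refl : reflexive quotmod_rel.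
Proof. by move=> x; apply/asboolP; rewrite subrr; exact: submod0. Qed.

Lemma quotmod_sym : symmetric quotmod_rel.
Proof.
by move=> x y; apply/idP/idP => /asboolP /submodN h; apply/asboolP;
  rewrite opprB in h.
Qed.

Lemma quotmod_trans : transitive quotmod_rel.
Proof.
move=> y x z /asboolP xy /asboolP yz; apply/asboolP.
by rewrite -(subrKA y); apply: submodD.
Qed.

Definition quotmod_equiv :=
  EquivRel quotmod_rel quotmod_refl quotmod_sym quotmod_trans.

Definition quotmod : Type := {eq_quot quotmod_equiv}%qT.

HB.instance Definition _ := Choice.on quotmod.

Definition qpi (x : V) : quotmod := (\pi_({eq_quot quotmod_equiv}) x)%qT.
Definition qrepr (q : quotmod) : V := repr (q : {eq_quot quotmod_equiv}%qT).

Lemma qpiE x y : qpi x = qpi y <-> W (x - y).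
Proof. by split=> [/eqquotP/asboolP //|h]; apply/eqquotP/asboolP. Qed.

Lemma qreprK q : qpi (qrepr q) = q.
Proof. exact: reprK. Qed.

Lemma quotmod_ind (P : quotmod -> Prop) :
  (forall x, P (qpi x)) -> forall q, P q.
Proof. by move=> h q; rewrite -(qreprK q). Qed.

Lemma qrepr_pi x : W (qrepr (qpi x) - x).
Proof. by apply/qpiE; rewrite qreprK. Qed.

Definition quot_opp (p : quotmod) := qpi (- qrepr p).
Definition quot_add (p q : quotmod) := qpi (qrepr p + qrepr q).
Definition quot_scale a (p : quotmod) := qpi (a *: qrepr p).

Lemma quot_oppE x : quot_opp (qpi x) = qpi (- x).
Proof. by apply/qpiE; rewrite -opprD; apply/submodN/qrepr_pi. Qed.
Lemma quot_addE x y : quot_add (qpi x) (qpi y) = qpi (x + y).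
Proof.
by apply/qpiE; rewrite opprD addrACA; apply: submodD; exact: qrepr_pi.
Qed.
Lemma quot_scaleE a x : quot_scale a (qpi x) = qpi (a *: x).
Proof. by apply/qpiE; rewrite -scalerBr; apply/submodZ/qrepr_pi. Qed.

Let quotE := (quot_oppE, quot_addE, quot_scaleE).

Fact quot_addrA : associative quot_add.
Proof.
elim/quotmod_ind=> x; elim/quotmod_ind=> y; elim/quotmod_ind=> z.
by rewrite !quotE addrA.
Qed.
Fact quot_addrC : commutative quot_add.
Proof.
by elim/quotmod_ind=> x; elim/quotmod_ind=> y; rewrite !quotE addrC.
Qed.
Fact quot_add0r : left_id (qpi 0) quot_add.
Proof. by elim/quotmod_ind=> x; rewrite !quotE add0r. Qed.
Fact quot_addNr : left_inverse (qpi 0) quot_opp quot_add.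
Proof. by elim/quotmod_ind=> x; rewrite !quotE addNr. Qed.

HB.instance Definition _ := GRing.isZmodule.Build quotmod
  quot_addrA quot_addrC quot_add0r quot_addNr.

Lemma qpiD x y : qpi (x + y) = qpi x + qpi y.
Proof. by rewrite -quot_addE. Qed.
Lemma qpiN x : qpi (- x) = - qpi x.
Proof. by rewrite -quot_oppE. Qed.
Lemma qpi0 : qpi 0 = 0.
Proof. by []. Qed.

Fact quot_scalerA a b p :
  quot_scale a (quot_scale b p) = quot_scale (a * b) p.
Proof. by elim/quotmod_ind: p => x; rewrite !quotE scalerA. Qed.
Fact quot_scale1r : left_id 1 quot_scale.
Proof. by elim/quotmod_ind=> x; rewrite !quotE scale1r. Qed.
Fact quot_scalerDr : right_distributive quot_scale +%R.
Proof.
move=> a; elim/quotmod_ind=> x; elim/quotmod_ind=> y.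
by rewrite -qpiD !quotE -qpiD scalerDr.
Qed.
Fact quot_scalerDl p : {morph quot_scale^~ p : a b / a + b}.
Proof.
by move=> a b; elim/quotmod_ind: p => x; rewrite !quotE -qpiD scalerDl.
Qed.

HB.instance Definition _ := GRing.Zmodule_isLmodule.Build K quotmod
  quot_scalerA quot_scale1r quot_scalerDr quot_scalerDl.

Lemma qpiZ a x : qpi (a *: x) = a *: qpi x.
Proof. by rewrite -quot_scaleE. Qed.

Lemma qpi_eq0 x : qpi x = 0 <-> W x.
Proof. by rewrite -qpi0 qpiE subr0. Qed.

End QuotMod.

Record lie_filtration (K : fieldType) (L : lieAlgType K) := LieFiltration {
  fil :> nat -> submod L;
  fil0 : forall x, fil 0 x -> x = 0;
  filS : forall j x, fil j x -> fil j.+1 x;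
  fil_lieb : forall i j x y, fil i x -> fil j y -> fil (i + j)%N [lie x, y];
  fil_exhaustive : forall x, exists j, fil j x
}.

Section FiltrationTheory.
Variables (K : fieldType) (L : lieAlgType K) (F : lie_filtration L).

Lemma fil_leq i j x : (i <= j)%N -> F i x -> F j x.
Proof.
move=> /subnK <-; elim: (j - i)%N => [//|d IH] Fx.
by rewrite addSn; apply/filS/IH.
Qed.

End FiltrationTheory.

(* The associated graded Lie algebra of F is the direct sum of the F_j/F_{j-1}: *)
(* families (a_j)_j with finite support, a_j lying in the image of F_j in       *)
(* L/F_{j-1}. The index j = 0 contributes F_0/F_0 = 0, since 0.-1 = 0.          *)
Section AssociatedGraded.
Variables (K : fieldType) (L : lieAlgType K) (F : lie_filtration L).

Local Notation family := (forall j : nat, quotmod (F j.-1)).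

Record gr_ok (a : family) : Prop := GrOk {
  gr_in_fil : forall j, exists2 x, F j x & a j = qpi (F j.-1) x;
  gr_fin_supp : exists N, forall j, (N <= j)%N -> a j = 0
}.

Record gr_type : Type := GrElt { gr_fun :> family; gr_funP : gr_ok gr_fun }.

HB.instance Definition _ := gen_eqMixin gr_type.
HB.instance Definition _ := gen_choiceMixin gr_type.

Lemma gr_ext (a b : gr_type) : (forall j, a j = b j) -> a = b.
Proof.
case: a b => [a aP] [b bP] /= ab.
have {}ab : a = b by exact: functional_extensionality_dep.
by rewrite -{}ab in bP *; rewrite (Prop_irrelevance aP bP).
Qed.

Fact gr_zero_ok : gr_ok (fun j => 0).
Proof.
split; last by exists 0%N.
by move=> j; exists 0; [exact: submod0|rewrite qpi0].
Qed.

Fact gr_opp_ok (a : gr_type) : gr_ok (fun j => - a j).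
Proof.
case: (gr_funP a) => aF [N aN]; split.
  move=> j; have [x Fx ->] := aF j.
  by exists (- x); [exact: submodN|rewrite qpiN].
by exists N => j /aN ->; rewrite oppr0.
Qed.

Fact gr_add_ok (a b : gr_type) : gr_ok (fun j => a j + b j).
Proof.
case: (gr_funP a) => aF [N aN]; case: (gr_funP b) => bF [M bM]; split.
  move=> j; have [x Fx ->] := aF j; have [y Fy ->] := bF j.
  by exists (x + y); [exact: submodD|rewrite qpiD].
exists (maxn N M) => j; rewrite geq_max => /andP[/aN -> /bM ->].
by rewrite addr0.
Qed.

Fact gr_scale_ok c (a : gr_type) : gr_ok (fun j => c *: a j).
Proof.
case: (gr_funP a) => aF [N aN]; split.
  move=> j; have [x Fx ->] := aF j.
  by exists (c *: x); [exact: submodZ|rewrite qpiZ].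
by exists N => j /aN ->; rewrite scaler0.
Qed.

Definition gr_zero := GrElt gr_zero_ok.
Definition gr_opp a := GrElt (gr_opp_ok a).
Definition gr_add a b := GrElt (gr_add_ok a b).
Definition gr_scale c a := GrElt (gr_scale_ok c a).

Fact gr_addrA : associative gr_add.
Proof. by move=> a b c; apply: gr_ext => j /=; rewrite addrA. Qed.
Fact gr_addrC : commutative gr_add.
Proof. by move=> a b; apply: gr_ext => j /=; rewrite addrC. Qed.
Fact gr_add0r : left_id gr_zero gr_add.
Proof. by move=> a; apply: gr_ext => j /=; rewrite add0r. Qed.
Fact gr_addNr : left_inverse gr_zero gr_opp gr_add.
Proof. by move=> a; apply: gr_ext => j /=; rewrite addNr. Qed.

HB.instance Definition _ := GRing.isZmodule.Build gr_type
  gr_addrA gr_addrC gr_add0r gr_addNr.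

Fact gr_scalerA c d a : gr_scale c (gr_scale d a) = gr_scale (c * d) a.
Proof. by apply: gr_ext => j /=; rewrite scalerA. Qed.
Fact gr_scale1r : left_id 1 gr_scale.
Proof. by move=> a; apply: gr_ext => j /=; rewrite scale1r. Qed.
Fact gr_scalerDr : right_distributive gr_scale +%R.
Proof. by move=> c a b; apply: gr_ext => j /=; rewrite scalerDr. Qed.
Fact gr_scalerDl a : {morph gr_scale^~ a : c d / c + d}.
Proof. by move=> c d; apply: gr_ext => j /=; rewrite scalerDl. Qed.

HB.instance Definition _ := GRing.Zmodule_isLmodule.Build K gr_type
  gr_scalerA gr_scale1r gr_scalerDr gr_scalerDl.

Lemma gr_funD (a b : gr_type) j : (a + b) j = a j + b j.
Proof. by []. Qed.
Lemma gr_funZ c (a : gr_type) j : (c *: a) j = c *: a j.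
Proof. by []. Qed.
Lemma gr_fun0 j : (0 : gr_type) j = 0.
Proof. by []. Qed.

(* [x + F_{i-1}, y + F_{j-1}] = [x, y] + F_{i+j-1}, extended bilinearly. *)
Definition gr_br_fun (a b : family) : family := fun k =>
  \sum_(i < k.+1) qpi (F k.-1) [lie qrepr (a i), qrepr (b (k - i)%N)].

Definition gr_rep (a : family) (x : nat -> L) :=
  forall j, F j (x j) /\ a j = qpi (F j.-1) (x j).

Lemma gr_rep_exists (a : gr_type) : exists x, gr_rep a x.
Proof.
exists (fun j => qrepr (a j)) => j; split; last by rewrite qreprK.
have [x Fx ->] := gr_in_fil (gr_funP a) j.
rewrite -(subrK x (qrepr _)); apply: submodD => //.
by apply: fil_leq (qrepr_pi _ _); exact: leq_pred.
Qed.

Definition lie_conv (x y : nat -> L) k : L :=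
  \sum_(i < k.+1) [lie x i, y (k - i)%N].

Lemma qpi_lieb i j k x x' y y' : (i + j)%N = k -> F i x -> F i x' -> F j y -> F j y' ->
  F i.-1 (x - x') -> F j.-1 (y - y') ->
  qpi (F k.-1) [lie x, y] = qpi (F k.-1) [lie x', y'].
Proof.
move=> <- Fx Fx' Fy Fy' xx' yy'; apply/qpiE.
have -> : [lie x, y] - [lie x', y'] = [lie x - x', y] + [lie x', y - y'].
  by rewrite liebBl liebBr addrA subrK.
apply: submodD.
  case: i Fx Fx' xx' => [|i] _ _ xx'; last by exact: fil_lieb.
  by rewrite (fil0 xx') lieb0l; exact: submod0.
case: j Fy Fy' yy' => [|j] _ _ yy'; last by rewrite addnS; exact: fil_lieb.
by rewrite (fil0 yy') lieb0r; exact: submod0.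
Qed.

Lemma qpi_sum (W : submod L) I (r : seq I) (P : pred I) (f : I -> L) :
  qpi W (\sum_(i <- r | P i) f i) = \sum_(i <- r | P i) qpi W (f i).
Proof. by elim/big_rec2: _ => [|i u v _ <-]; rewrite ?qpi0 ?qpiD. Qed.

Lemma gr_br_rep (a b : family) x y : gr_rep a x -> gr_rep b y ->
  gr_rep (gr_br_fun a b) (lie_conv x y).
Proof.
move=> ax by_ k; split.
  apply: submod_sum => i _; rewrite -{1}(subnKC (ltnSE (ltn_ord i))).
  by apply: fil_lieb; [case: (ax i)|case: (by_ (k - i)%N)].
have rep c z : gr_rep c z -> forall j,
    [/\ F j (qrepr (c j)), F j (z j) & F j.-1 (qrepr (c j) - z j)].
  move=> cz j; have [Fz ->] := cz j; have h := qrepr_pi (F j.-1) (z j).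
  split=> //; rewrite -(subrK (z j) (qrepr _)); apply: submodD => //.
  by apply: fil_leq h; exact: leq_pred.
rewrite /gr_br_fun qpi_sum; apply: eq_bigr => i _.
have [? ? ?] := rep _ _ ax i; have [? ? ?] := rep _ _ by_ (k - i)%N.
exact: qpi_lieb (subnKC (ltnSE (ltn_ord i))) _ _ _ _ _ _.
Qed.

Fact gr_br_ok (a b : gr_type) : gr_ok (gr_br_fun a b).
Proof.
have [x ax] := gr_rep_exists a; have [y by_] := gr_rep_exists b.
split=> [j|]; first by have [? ?] := gr_br_rep ax by_ j; exists (lie_conv x y j).
have [N aN] := gr_fin_supp (gr_funP a); have [M bM] := gr_fin_supp (gr_funP b).
exists (N + M)%N => k NMk; apply: big1 => i _.
have ikE := subnKC (ltnSE (ltn_ord i)).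
have zrep (c : gr_type) j : F j (qrepr (c j)).
  have [z Fz ->] := gr_in_fil (gr_funP c) j.
  rewrite -(subrK z (qrepr _)); apply: submodD => //.
  by apply: fil_leq (qrepr_pi _ _); exact: leq_pred.
have [Ni|iN] := leqP N i.
  rewrite (@qpi_lieb i (k - i) k _ 0 _ (qrepr (b (k - i)%N))) ?lieb0l ?qpi0 //.
  - exact: submod0.
  - by rewrite subr0; apply/qpi_eq0; rewrite qreprK aN.
  - by rewrite subrr; exact: submod0.
have Mi : (M <= k - i)%N.
  by rewrite leq_subRL ?(ltnSE (ltn_ord i)) // (leq_trans _ NMk) // leq_add2r ltnW.
rewrite (@qpi_lieb i (k - i) k _ (qrepr (a i)) _ 0) ?lieb0r ?qpi0 //.
- exact: submod0.
- by rewrite subrr; exact: submod0.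
- by rewrite subr0; apply/qpi_eq0; rewrite qreprK bM.
Qed.

Definition gr_br (a b : gr_type) : gr_type := GrElt (gr_br_ok a b).

Lemma gr_rep_inj (a b : family) x : gr_rep a x -> gr_rep b x -> forall j, a j = b j.
Proof. by move=> ax bx j; case: (ax j) (bx j) => _ -> [_ ->]. Qed.

Lemma gr_repD (a b : gr_type) x y :
  gr_rep a x -> gr_rep b y -> gr_rep (a + b) (fun j => x j + y j).
Proof.
move=> ax by_ j; rewrite gr_funD; case: (ax j) (by_ j) => Fx -> [Fy ->].
by split; [exact: submodD|rewrite qpiD].
Qed.

Lemma gr_repZ c (a : gr_type) x :
  gr_rep a x -> gr_rep (c *: a) (fun j => c *: x j).
Proof.
move=> ax j; rewrite gr_funZ; case: (ax j) => Fx ->.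
by split; [exact: submodZ|rewrite qpiZ].
Qed.

Lemma gr_rep_ext (a : family) x y : x =1 y -> gr_rep a x -> gr_rep a y.
Proof. by move=> xy ax j; rewrite -xy. Qed.

Fact gr_brDl a b c : gr_br (a + b) c = gr_br a c + gr_br b c.
Proof.
have [x ax] := gr_rep_exists a; have [y by_] := gr_rep_exists b.
have [z cz] := gr_rep_exists c; apply/gr_ext.
apply: gr_rep_inj (gr_br_rep (gr_repD ax by_) cz) _.
apply: gr_rep_ext; last first.
  by apply: gr_repD; [exact: (gr_br_rep ax cz)|exact: (gr_br_rep by_ cz)].
by move=> k; rewrite -big_split; apply: eq_bigr => i _; rewrite liebDl.
Qed.

Fact gr_brDr a b c : gr_br a (b + c) = gr_br a b + gr_br a c.
Proof.
have [x ax] := gr_rep_exists a; have [y by_] := gr_rep_exists b.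
have [z cz] := gr_rep_exists c; apply/gr_ext.
apply: gr_rep_inj (gr_br_rep ax (gr_repD by_ cz)) _.
apply: gr_rep_ext; last first.
  by apply: gr_repD; [exact: (gr_br_rep ax by_)|exact: (gr_br_rep ax cz)].
by move=> k; rewrite -big_split; apply: eq_bigr => i _; rewrite liebDr.
Qed.

Fact gr_brZl d a b : gr_br (d *: a) b = d *: gr_br a b.
Proof.
have [x ax] := gr_rep_exists a; have [y by_] := gr_rep_exists b.
apply/gr_ext; apply: gr_rep_inj (gr_br_rep (gr_repZ d ax) by_) _.
apply: gr_rep_ext; last by apply: gr_repZ; exact: (gr_br_rep ax by_).
by move=> k; rewrite scaler_sumr; apply: eq_bigr => i _; rewrite liebZl.
Qed.

Fact gr_brZr d a b : gr_br a (d *: b) = d *: gr_br a b.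
Proof.
have [x ax] := gr_rep_exists a; have [y by_] := gr_rep_exists b.
apply/gr_ext; apply: gr_rep_inj (gr_br_rep ax (gr_repZ d by_)) _.
apply: gr_rep_ext; last by apply: gr_repZ; exact: (gr_br_rep ax by_).
by move=> k; rewrite scaler_sumr; apply: eq_bigr => i _; rewrite liebZr.
Qed.

Lemma lie_convE x y N k : (k < N)%N ->
  lie_conv x y k = \sum_(i < N) \sum_(j < N | (i + j == k)%N) [lie x i, y j].
Proof.
move=> kN; rewrite /lie_conv.
rewrite (big_ord_widen N (fun i => [lie x i, y (k - i)%N]) kN).
rewrite [RHS](bigID (fun i : 'I_N => (i < k.+1)%N)) /= [X in _ + X]big1 ?addr0.
  apply: eq_bigr => i; rewrite ltnS => ik.
  have kiN : (k - i < N)%N by exact: leq_ltn_trans (leq_subr _ _) kN.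
  rewrite (big_pred1 (Ordinal kiN)) // => j.
  by rewrite /= -(inj_eq val_inj) /= -[RHS](eqn_add2l i) subnKC.
move=> i; rewrite -leqNgt => ki; rewrite big_pred0 // => j.
by apply: gtn_eqF; exact: leq_trans ki (leq_addr _ _).
Qed.

Lemma alt_sum0 N (G : nat -> nat -> L) :
  (forall i, G i i = 0) -> (forall i j, G j i = - G i j) ->
  \sum_(i < N) \sum_(j < N) G i j = 0.
Proof.
move=> G0 GN; elim: N => [|N IH]; first by rewrite big_ord0.
rewrite big_ord_recr /= big_ord_recr /= G0 addr0.
under eq_bigr do rewrite big_ord_recr /=.
rewrite big_split /= IH add0r -big_split /= big1 // => i _.
by rewrite (GN i) subrr.
Qed.

Lemma lie_convxx x k : lie_conv x x k = 0.
Proof.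
rewrite (lie_convE _ _ (ltnSn k)).
under eq_bigr do rewrite big_mkcond.
apply: (alt_sum0 _ (G := fun i j => if (i + j == k)%N then [lie x i, x j] else 0)).
  by move=> i; rewrite liebxx if_same.
by move=> i j; rewrite addnC; case: ifP => _; rewrite ?oppr0 // liebC.
Qed.

Lemma lie_conv3 x y z k : lie_conv x (lie_conv y z) k =
  \sum_(i < k.+1) \sum_(j < k.+1) \sum_(l < k.+1)
    if (i + j + l == k)%N then [lie x i, [lie y j, z l]] else 0.
Proof.
apply: eq_bigr => i _; have ik := ltnSE (ltn_ord i).
rewrite (@lie_convE _ _ k.+1) ?ltnS ?leq_subr // lieb_sumr.
apply: eq_bigr => j _; rewrite lieb_sumr -big_mkcond; apply: eq_bigl => l.
by rewrite -(eqn_add2l i) subnKC // addnA.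
Qed.

Lemma lie_conv_jacobi x y z k :
  lie_conv x (lie_conv y z) k + lie_conv y (lie_conv z x) k
  + lie_conv z (lie_conv x y) k = 0.
Proof.
rewrite !lie_conv3.
pose G2 (i j l : 'I_k.+1) :=
  if (j + l + i == k)%N then [lie y j, [lie z l, x i]] else 0.
pose G3 (i j l : 'I_k.+1) :=
  if (l + i + j == k)%N then [lie z l, [lie x i, y j]] else 0.
have E2 : \sum_j \sum_l \sum_i G2 i j l = \sum_i \sum_j \sum_l G2 i j l.
  under eq_bigr do rewrite exchange_big /=.
  by rewrite exchange_big.
have E3 : \sum_l \sum_i \sum_j G3 i j l = \sum_i \sum_j \sum_l G3 i j l.
  rewrite exchange_big /=; apply: eq_bigr => i _.
  by rewrite exchange_big.
rewrite E2 E3 -!big_split /= big1 // => i _.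
rewrite -!big_split /= big1 // => j _.
rewrite -!big_split /= big1 // => l _.
rewrite /G2 /G3 (addnC (j + l)%N) addnA -(addnA l) (addnC l).
by case: ifP => _; rewrite ?lieb_jacobi // !addr0.
Qed.

Fact gr_brxx a : gr_br a a = 0.
Proof.
have [x ax] := gr_rep_exists a; apply/gr_ext => j.
have [_ E] := gr_br_rep ax ax j; rewrite [LHS]E.
by rewrite lie_convxx qpi0.
Qed.

Fact gr_br_jacobi a b c :
  gr_br a (gr_br b c) + gr_br b (gr_br c a) + gr_br c (gr_br a b) = 0.
Proof.
have [x ax] := gr_rep_exists a; have [y by_] := gr_rep_exists b.
have [z cz] := gr_rep_exists c; apply/gr_ext => k; rewrite !gr_funD.
have [_ E1] := gr_br_rep ax (gr_br_rep by_ cz) k.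
have [_ E2] := gr_br_rep by_ (gr_br_rep cz ax) k.
have [_ E3] := gr_br_rep cz (gr_br_rep ax by_) k.
rewrite [X in X + _ + _]E1 [X in _ + X + _]E2 [X in _ + X]E3.
by rewrite -!qpiD lie_conv_jacobi qpi0.
Qed.

HB.instance Definition _ := Lmodule_isLieAlg.Build K gr_type
  gr_brDl gr_brDr gr_brZl gr_brZr gr_brxx gr_br_jacobi.

Definition gr_component (k : nat) : set gr_type :=
  [set a : gr_type | forall j, j != k -> a j = 0].

Definition gr_class_fun (j : nat) (x : L) : family :=
  fun k => if k == j then qpi (F k.-1) x else 0.

Fact gr_class_ok j x : F j x -> gr_ok (gr_class_fun j x).
Proof.
move=> Fx; split=> [k|]; last first.
  by exists j.+1 => k jk; rewrite /gr_class_fun gtn_eqF.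
rewrite /gr_class_fun; case: eqP => [->|_]; first by exists x.
by exists 0; [exact: submod0|rewrite qpi0].
Qed.

(* The class [x]_j = x + F_{j-1}, for x in F_j. *)
Definition gr_class j x (Fx : F j x) : gr_type := GrElt (gr_class_ok Fx).

End AssociatedGraded.

Definition gen_cartan_matrix n (A : 'M[int]_n) : Prop :=
  [/\ forall i, A i i = 2,
      forall i j, i != j -> A i j <= 0
    & forall i j, A i j = 0 -> A j i = 0].

Definition symmetrizable (K : fieldType) n (A : 'M[int]_n) : Prop :=
  exists (d : 'rV[K]_n) (S : 'M[K]_n),
    [/\ forall i, d 0 i != 0, S^T = S & map_mx intr A = diag_mx d *m S].

(* The Serre exponent 1 - a_ij; it is only used for i != j, where a_ij <= 0. *)
Definition serre_exp n (A : 'M[int]_n) (i j : 'I_n) : nat := `|1 - A i j|%N.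

Record realization (K : fieldType) n (A : 'M[int]_n) := Realization {
  rz_h : vectType K;
  rz_root : 'I_n -> 'Hom(rz_h, K^o);
  rz_coroot : 'I_n -> rz_h;
  rz_dim : \dim {: rz_h} = (n.*2 - \rank (map_mx intr A : 'M[K]_n))%N;
  rz_root_free : free (codom rz_root);
  rz_coroot_free : free (codom rz_coroot);
  rz_pairing : forall i j, rz_root j (rz_coroot i) = (A i j)%:~R
}.

Section KacMoody.
Variables (K : fieldType) (n : nat) (A : 'M[int]_n) (rz : realization K A).

Local Notation h := (rz_h rz).
Local Notation alpha := (rz_root rz).
Local Notation coroot := (rz_coroot rz).

Inductive km_generator : Type := KMh of h | KMe of 'I_n | KMf of 'I_n.

Local Notation term := (lie_term K km_generator).
Local Notation tH x := (LGen (KMh x) : term).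
Local Notation tE i := (LGen (KMe i) : term).
Local Notation tF i := (LGen (KMf i) : term).

(* The first relation makes the generators from h a linear image of the       *)
(* vector space h.                                                            *)
Inductive km_rel : term -> term -> Prop :=
| KMlin a x y : km_rel (tH (a *: x + y)) (LAdd (LScale a (tH x)) (tH y))
| KMhh x y : km_rel (LBr (tH x) (tH y)) LZero
| KMhe x j : km_rel (LBr (tH x) (tE j)) (LScale (alpha j x) (tE j))
| KMhf x j : km_rel (LBr (tH x) (tF j)) (LScale (- alpha j x) (tF j))
| KMef i j :
    km_rel (LBr (tE i) (tF j)) (if i == j then tH (coroot i) else LZero)
| KMserre_e i j : i != j ->
    km_rel (iter (serre_exp A i j) (LBr (tE i)) (tE j)) LZero
| KMserre_f i j : i != j ->
    km_rel (iter (serre_exp A i j) (LBr (tF i)) (tF j)) LZero.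

Definition kac_moody : lieAlgType K := lie_pres km_rel.

Definition km_h (x : h) : kac_moody := pres_gen km_rel (KMh x).
Definition km_e (i : 'I_n) : kac_moody := pres_gen km_rel (KMe i).
Definition km_f (i : 'I_n) : kac_moody := pres_gen km_rel (KMf i).

Lemma km_h_linear : linear km_h.
Proof.
move=> a x y; rewrite /km_h /pres_gen.
have /pres_piE -> := LCrel (KMlin a x y).
by rewrite pres_piD pres_piZ.
Qed.

Lemma km_hh x y : [lie km_h x, km_h y] = 0.
Proof. by rewrite -pres_piB; apply/pres_piE/LCrel/KMhh. Qed.

Lemma km_he x j : [lie km_h x, km_e j] = (alpha j x : K) *: km_e j.
Proof. by rewrite -pres_piB -pres_piZ; apply/pres_piE/LCrel/KMhe. Qed.

Lemma km_hf x j : [lie km_h x, km_f j] = - (alpha j x : K) *: km_f j.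
Proof. by rewrite -pres_piB -pres_piZ; apply/pres_piE/LCrel/KMhf. Qed.

Lemma km_ef i j :
  [lie km_e i, km_f j] = if i == j then km_h (coroot i) else 0.
Proof.
rewrite -pres_piB; have /pres_piE -> := LCrel (KMef i j).
by case: ifP.
Qed.

Lemma pres_pi_iter_br (t u : term) m :
  pres_pi km_rel (iter m (LBr t) u)
  = iter m (lieb (pres_pi km_rel t)) (pres_pi km_rel u).
Proof. by elim: m => //= m IH; rewrite pres_piB IH. Qed.

Lemma km_serre_e i j : i != j ->
  iter (serre_exp A i j) (lieb (km_e i)) (km_e j) = 0.
Proof. by move=> ij; rewrite -pres_pi_iter_br; apply/pres_piE/LCrel/KMserre_e. Qed.

Lemma km_serre_f i j : i != j ->
  iter (serre_exp A i j) (lieb (km_f i)) (km_f j) = 0.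
Proof. by move=> ij; rewrite -pres_pi_iter_br; apply/pres_piE/LCrel/KMserre_f. Qed.

Definition chevalley_gen (x : km_generator) : kac_moody :=
  match x with
  | KMh y => - km_h y
  | KMe i => - km_f i
  | KMf i => - km_e i
  end.

Definition chevalley : kac_moody -> kac_moody :=
  pres_lift (rel := km_rel) chevalley_gen.

Lemma iter_liebN (x y : kac_moody) m : iter m (lieb x) y = 0 ->
  iter m (lieb (- x)) (- y) = 0.
Proof.
have -> : iter m (lieb (- x)) (- y) = (-1) ^+ m.+1 *: iter m (lieb x) y.
  elim: m => [|m IH] /=; first by rewrite scaleN1r.
  by rewrite IH liebZr liebNl scalerN [in RHS]exprS mulN1r scaleNr.
by move=> ->; rewrite scaler0.
Qed.

Lemma lie_eval_iter (L : lieAlgType K) (f : km_generator -> L) (t u : term) m :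
  lie_eval f (iter m (LBr t) u) = iter m (lieb (lie_eval f t)) (lie_eval f u).
Proof. by elim: m => //= m ->. Qed.

Lemma chevalley_rel t u : km_rel t u ->
  lie_eval chevalley_gen t = lie_eval chevalley_gen u.
Proof.
case=> /= [a x y|x y|x j|x j|i j|i j ij|i j ij].
- by rewrite km_h_linear opprD scalerN.
- by rewrite liebNl liebNr km_hh !oppr0.
- by rewrite liebNl liebNr opprK km_hf scaleNr scalerN.
- by rewrite liebNl liebNr opprK km_he scaleNr scalerN opprK.
- rewrite liebNl liebNr opprK liebC km_ef eq_sym.
  by case: eqP => [->|_] //=; rewrite oppr0.
- by rewrite lie_eval_iter; apply/iter_liebN/km_serre_f.
- by rewrite lie_eval_iter; apply/iter_liebN/km_serre_e.
Qed.

Lemma chevalley_hom : lie_hom chevalley.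
Proof. exact: pres_lift_hom chevalley_rel. Qed.

Lemma chevalley_h x : chevalley (km_h x) = - km_h x.
Proof. exact: (pres_lift_gen chevalley_rel (KMh x)). Qed.
Lemma chevalley_e i : chevalley (km_e i) = - km_f i.
Proof. exact: (pres_lift_gen chevalley_rel (KMe i)). Qed.
Lemma chevalley_f i : chevalley (km_f i) = - km_e i.
Proof. exact: (pres_lift_gen chevalley_rel (KMf i)). Qed.

Lemma chevalley_involutive : involutive chevalley.
Proof.
have genE t u : km_rel t u -> lie_eval (pres_gen km_rel) t
    = lie_eval (pres_gen km_rel) u.
  have evalE v : lie_eval (pres_gen km_rel) v = pres_pi km_rel v.
    elim: v => //= [v -> w ->|v ->|a v ->|v -> w ->].
    - by rewrite pres_piD.
    - by rewrite pres_piN.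
    - by rewrite pres_piZ.
    - by rewrite pres_piB.
  by rewrite !evalE => tu; apply/pres_piE/LCrel.
have [lin br] := chevalley_hom.
have chevN x : chevalley (- x) = - chevalley x.
  have := lin (-1) x (- x + x); rewrite addNr addr0 !scaleN1r => ->.
  have := lin 1 0 0; rewrite scale1r addr0 => /eqP.
  by rewrite scale1r -subr_eq subrr eq_sym => /eqP ->; rewrite addr0.
move=> x; transitivity (pres_lift (rel := km_rel) (pres_gen km_rel) x); last first.
  by apply/esym/(pres_lift_unique genE (g := id)).
apply: (pres_lift_unique genE (g := chevalley \o chevalley)).
  by split=> [a y z|y z] /=; rewrite ?lin ?br.
by case=> [y|i|i]; rewrite /= ?(chevalley_h, chevalley_e, chevalley_f) chevN
  ?(chevalley_h, chevalley_e, chevalley_f) opprK.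
Qed.

Definition chevalley_fixed : lie_subalg kac_moody :=
  fixed_subalg chevalley_hom.

Lemma chevalley_fixed_Y i : chevalley_fixed (km_e i - km_f i).
Proof.
rewrite /= addrC -scaleN1r (lie_hom_linear chevalley_hom).
by rewrite chevalley_e chevalley_f !scaleN1r opprK addrC.
Qed.

Definition km_k : lieAlgType K := subalg_type chevalley_fixed.
Definition km_Y (i : 'I_n) : km_k := subalg_elt (chevalley_fixed_Y i).

Definition km_n_subalg : lie_subalg kac_moody := generated_subalg (range km_e).

Lemma km_n_subalg_e i : km_n_subalg (km_e i).
Proof. by apply: lie_gen_gen; exists i. Qed.

Definition km_n : lieAlgType K := subalg_type km_n_subalg.
Definition km_n_e (i : 'I_n) : km_n := subalg_elt (km_n_subalg_e i).

Definition root_space (beta : 'Hom(h, K^o)) : set kac_moody :=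
  [set x | forall y, [lie km_h y, x] = (beta y : K) *: x].

Definition is_root (beta : 'Hom(h, K^o)) : Prop :=
  beta != 0 /\ exists2 x, x != 0 & root_space beta x.

Definition positive_root_of_height (k : nat) (beta : 'Hom(h, K^o)) : Prop :=
  is_root beta /\
  exists2 c : 'I_n -> nat,
    beta = \sum_i alpha i *+ c i & (\sum_i c i)%N = k.

Definition km_n_component (k : nat) : set km_n :=
  [set x : km_n | lspan
     [set y | exists2 beta, positive_root_of_height k beta
                          & root_space beta y]
     (subalg_val x)].

End KacMoody.

(* onsager_coef a r s is c_s^{ij}[r] for a = a_ij; it is 0 for s > r. *)
Fixpoint onsager_coef (a : int) (r s : nat) {struct r} : int :=
  match r with
  | 0 => if s == 0%N then 1 else 0
  | 1 => if s == 1%N then 1 else 0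
  | (r2.+1 as r1).+1 =>
      if s == r then 1
      else if (r1 <= s)%N then 0
      else (if s is s1.+1 then onsager_coef a r1 s1 else 0)
           - r1%:Z * (r2%:Z + a) * onsager_coef a r2 s
  end.

Lemma onsager_coef_diag a r : onsager_coef a r r = 1.
Proof. by case: r => [|[|r]] //=; rewrite eqxx. Qed.

Lemma onsager_coef_pred a r : onsager_coef a r.+1 r = 0.
Proof. by case: r => [//|r] /=; rewrite ltn_eqF // leqnn. Qed.

Lemma onsager_coef_rec a r s : (s <= r)%N ->
  onsager_coef a r.+2 s =
    (if s is s1.+1 then onsager_coef a r.+1 s1 else 0)
    - r.+1%:Z * (r%:Z + a) * onsager_coef a r s.
Proof.
move=> sr; rewrite [LHS]/= ltn_eqF; last by rewrite ltnS (leq_trans sr).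
by rewrite leqNgt ltnS sr.
Qed.

Section Onsager.
Variables (K : fieldType) (n : nat) (A : 'M[int]_n).

Local Notation term := (lie_term K 'I_n).

Definition onsager_term (i j : 'I_n) : term :=
  \big[@LAdd K 'I_n/LZero]_(s < (serre_exp A i j).+1)
    LScale (onsager_coef (A i j) (serre_exp A i j) s)%:~R
      (iter s (LBr (LGen i)) (LGen j)).

Inductive onsager_rel : term -> term -> Prop :=
| OnsagerRel i j : i != j -> onsager_rel (onsager_term i j) LZero.

Definition onsager : lieAlgType K := lie_pres onsager_rel.

Definition onsager_B (i : 'I_n) : onsager := pres_gen onsager_rel i.

Lemma onsager_relation i j : i != j ->
  \sum_(s < (serre_exp A i j).+1)
    (onsager_coef (A i j) (serre_exp A i j) s)%:~R
      *: iter s (lieb (onsager_B i)) (onsager_B j) = 0.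
Proof.
move=> /OnsagerRel /LCrel /pres_piE E; rewrite -[RHS]/(pres_pi onsager_rel LZero).
rewrite -E /onsager_term.
rewrite (big_morph (pres_pi onsager_rel) (pres_piD _) (pres_pi0 _)).
apply: eq_bigr => s _; rewrite pres_piZ; congr (_ *: _).
by elim: (nat_of_ord s) => //= m IH; rewrite pres_piB IH.
Qed.

(* onsager_word i [:: i_2; ..; i_m] is [B_i, .. [B_{i_(m-1)}, B_{i_m}] .. ].   *)
Fixpoint onsager_word (i : 'I_n) (s : seq 'I_n) : onsager :=
  if s is j :: s' then [lie onsager_B i, onsager_word j s'] else onsager_B i.

Definition onsager_words (j : nat) : set onsager :=
  [set x | exists i s, ((size s).+1 <= j)%N /\ x = onsager_word i s].

Definition onsager_fil (j : nat) : submod onsager :=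
  lspan_submod (onsager_words j).

Fact onsager_fil0 x : onsager_fil 0 x -> x = 0.
Proof.
elim=> {x} [x [i [s []]]|//|x y _ -> _ ->|a x _ ->] //.
  by rewrite addr0.
by rewrite scaler0.
Qed.

Lemma onsager_fil_sub i j x : (i <= j)%N -> onsager_fil i x -> onsager_fil j x.
Proof.
move=> ij; elim=> {x} [x [k [s [ks ->]]]||x y _ ? _ ?|a x _ ?].
- by apply: lspan_gen; exists k, s; split=> //; exact: leq_trans ks ij.
- exact: submod0.
- exact: submodD.
- exact: submodZ.
Qed.

Fact onsager_filS j x : onsager_fil j x -> onsager_fil j.+1 x.
Proof. exact: onsager_fil_sub. Qed.

Lemma onsager_fil_B i : onsager_fil 1 (onsager_B i).
Proof. by apply: lspan_gen; exists i, [::]. Qed.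

Lemma onsager_fil_lieB i j x :
  onsager_fil j x -> onsager_fil j.+1 [lie onsager_B i, x].
Proof.
elim=> {x} [x [k [s [ks ->]]]||x y _ ? _ ?|a x _ ?].
- by apply: lspan_gen; exists i, (k :: s).
- by rewrite lieb0r; exact: submod0.
- by rewrite liebDr; exact: submodD.
- by rewrite liebZr; exact: submodZ.
Qed.

Lemma onsager_fil_word i s j x : onsager_fil j x ->
  onsager_fil ((size s).+1 + j)%N [lie onsager_word i s, x].
Proof.
elim: s i j x => [|k s IH] i j x jx; first exact: onsager_fil_lieB.
rewrite lieb_leibniz; apply: submodB; first exact/onsager_fil_lieB/IH.
by rewrite addSnnS; apply/IH/onsager_fil_lieB.
Qed.

Fact onsager_fil_lieb i j x y :
  onsager_fil i x -> onsager_fil j y -> onsager_fil (i + j)%N [lie x, y].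
Proof.
move=> ix jy; elim: ix => {x} [x [k [s [ks ->]]]||x z _ ? _ ?|a x _ ?].
- by apply: onsager_fil_sub (onsager_fil_word k s jy); rewrite leq_add2r.
- by rewrite lieb0l; exact: submod0.
- by rewrite liebDl; exact: submodD.
- by rewrite liebZl; exact: submodZ.
Qed.

Fact onsager_fil_exhaustive x : exists j, onsager_fil j x.
Proof.
elim/pres_ind: x; elim=> [i||t [j tj] u [k uk]|t [j tj]|a t [j tj]|t [j tj] u [k uk]].
- by exists 1%N; exact: onsager_fil_B.
- by exists 0%N; rewrite pres_pi0; exact: submod0.
- exists (maxn j k); rewrite pres_piD; apply: submodD.
    by apply: onsager_fil_sub tj; exact: leq_maxl.
  by apply: onsager_fil_sub uk; exact: leq_maxr.
- by exists j; rewrite pres_piN; exact: submodN.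
- by exists j; rewrite pres_piZ; exact: submodZ.
- by exists (j + k)%N; rewrite pres_piB; exact: onsager_fil_lieb.
Qed.

Definition onsager_filtration : lie_filtration onsager :=
  LieFiltration onsager_fil0 onsager_filS onsager_fil_lieb
    onsager_fil_exhaustive.

Definition onsager_gr : lieAlgType K := gr_type onsager_filtration.

Definition onsager_gr_B (i : 'I_n) : onsager_gr :=
  gr_class (F := onsager_filtration) (onsager_fil_B i).

End Onsager.

(* Main.v *)
Require Import Defs.
From HB Require Import structures.
From mathcomp Require Import all_boot all_order all_algebra.
From mathcomp Require Import complex ring zify.
From mathcomp Require Import all_classical all_reals.

Set Implicit Arguments.
Unset Strict Implicit.
Unset Printing Implicit Defensive.

Import Order.TTheory GRing.Theory Num.Theory.

Local Open Scope ring_scope.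
Local Open Scope classical_set_scope.

(* Both maps are controlled by comparing leading terms. Writing x0 for an       *)
(* element of h with alpha_i(x0) = 1 for all i, the iterated brackets of the    *)
(* Y_i = e_i - f_i agree with those of the e_i up to terms of lower ad(x0)-     *)
(* eigenvalue. Hence if phi : n(A) -> Gr(L(A)) exists, then an element of L(A)  *)
(* killed by psi, or of n(A) killed by phi, has vanishing symbol, and induction *)
(* on the degree gives both injectivities. The existence of phi amounts to n(A) *)
(* being presented by the Serre relations; it is obtained by letting g(A) act   *)
(* on the functions from words in the e_i to M (the module coinduced from the   *)
(* negative half), cut down to those killed by the Serre relations: any         *)
(* operators beta_i on M satisfying the Serre relations are realized by the e_i *)
(* on a copy of M in it. Applied to the faithful action of Gr(L(A)) on its      *)
(* semidirect product with the degree derivation, this yields phi. For the      *)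
(* surjectivity of psi, x + omega(x) lies in the subalgebra generated by the Y_i*)
(* for every x in n(A), by induction on the degree.                             *)

(** The map psi exists because [ad Y_i] commutes with x |-> x + omega x. By the sl2 formula
    [f_string], [f_i, (ad e_i)^(m+1) e_j] = -(m+1)(m + a_ij) (ad e_i)^m e_j; hence the Onsager
    polynomials at (Y_i, Y_j) and the images of (ad e_i)^m e_j under x |-> x + omega x obey the same
    three-term recursion, and the Serre relation makes them vanish at m = 1 - a_ij
    ([km_onsager_relation]).

    The map phi exists because an Onsager relation has leading coefficient 1, so its top term is a
    Serre relation in the associated graded algebra ([onsager_gr_serre]), and because the subalgebra
    n(A) of g(A) has the universal property of the Serre presentation: first for operators
    ([km_n_operators]), then for Lie algebras with an injective derivation ([km_n_graded_hom]).

    A word of length j in the Y_i equals the same word in the e_i up to ad(x0)-eigenvalues below j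
    ([km_Y_word_leading]), and an eigenvector is never a sum of eigenvectors of smaller eigenvalues
    unless it is zero ([eigen_at_below0]). An element x of the j-th filtration step and its symbol y
    in degree j of n(A) thus control each other: psi x = 0 forces y = 0, so x drops one step
    ([onsager_psi_inj]), and phi y = 0 forces x to drop one step, so y = 0 ([phi_inj]). Surjectivity
    of phi removes top components one at a time ([phi_surj]); that of psi comes from g(A) = n(A) +
    h(A) + omega(n(A)) and induction on word length ([onsager_psi_surj]). *)

Section LinearPredicate.
Variables (K : fieldType) (V W : lmodType K) (f : V -> W).
Hypothesis lin_f : linear f.

Lemma lin0 : f 0 = 0.
Proof. by have := lin_f (-1) 0 0; rewrite scaler0 addr0 scaleN1r addNr. Qed.

Lemma linD x y : f (x + y) = f x + f y.
Proof. by rewrite -[x in LHS]scale1r lin_f scale1r. Qed.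

Lemma linZ a x : f (a *: x) = a *: f x.
Proof. by rewrite -[a *: x]addr0 lin_f lin0 addr0. Qed.

Lemma linN x : f (- x) = - f x.
Proof. by rewrite -scaleN1r linZ scaleN1r. Qed.

Lemma linB x y : f (x - y) = f x - f y.
Proof. by rewrite linD linN. Qed.

End LinearPredicate.

Lemma linear_inj (K : fieldType) (V W : lmodType K) (f : V -> W) :
  linear f -> (forall x, f x = 0 -> x = 0) -> injective f.
Proof.
move=> lin f0 x y xy; apply/eqP; rewrite -subr_eq0; apply/eqP/f0.
by rewrite (linB lin) xy subrr.
Qed.

(** * Linear operators as a Lie algebra *)

Section LinearOperators.
Variables (K : fieldType) (V : lmodType K).

Record linop := LinOp { linop_fun :> V -> V; linop_linear : linear linop_fun }.

HB.instance Definition _ := gen_eqMixin linop.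
HB.instance Definition _ := gen_choiceMixin linop.

Lemma linop_ext (f g : linop) : f =1 g -> f = g.
Proof.
case: f g => [f lf] [g lg] /= /funext fg.
by rewrite -{}fg in lg *; rewrite (Prop_irrelevance lf lg).
Qed.

Implicit Types f g h : linop.

Fact linop_zero_linear : linear (fun _ : V => 0 : V).
Proof. by move=> a x y; rewrite scaler0 addr0. Qed.
Fact linop_opp_linear f : linear (fun x => - f x).
Proof. by move=> a x y; rewrite linop_linear opprD scalerN. Qed.
Fact linop_add_linear f g : linear (fun x => f x + g x).
Proof. by move=> a x y; rewrite !linop_linear scalerDr addrACA. Qed.
Fact linop_scale_linear c f : linear (fun x => c *: f x).
Proof.
by move=> a x y; rewrite linop_linear scalerDr !scalerA (mulrC c).
Qed.
Fact linop_br_linear f g : linear (fun x => f (g x) - g (f x)).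
Proof.
by move=> a x y; rewrite !linop_linear scalerBr opprD addrACA.
Qed.

Definition linop_zero := LinOp linop_zero_linear.
Definition linop_opp f := LinOp (linop_opp_linear f).
Definition linop_add f g := LinOp (linop_add_linear f g).
Definition linop_scale c f := LinOp (linop_scale_linear c f).
Definition linop_br f g := LinOp (linop_br_linear f g).

Fact linop_addA : associative linop_add.
Proof. by move=> f g h; apply: linop_ext => x /=; rewrite addrA. Qed.
Fact linop_addC : commutative linop_add.
Proof. by move=> f g; apply: linop_ext => x /=; rewrite addrC. Qed.
Fact linop_add0 : left_id linop_zero linop_add.
Proof. by move=> f; apply: linop_ext => x /=; rewrite add0r. Qed.
Fact linop_addN : left_inverse linop_zero linop_opp linop_add.
Proof. by move=> f; apply: linop_ext => x /=; rewrite addNr. Qed.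

HB.instance Definition _ := GRing.isZmodule.Build linop
  linop_addA linop_addC linop_add0 linop_addN.

Fact linop_scaleA a b f : linop_scale a (linop_scale b f) = linop_scale (a * b) f.
Proof. by apply: linop_ext => x /=; rewrite scalerA. Qed.
Fact linop_scale1 : left_id 1 linop_scale.
Proof. by move=> f; apply: linop_ext => x /=; rewrite scale1r. Qed.
Fact linop_scaleDr : right_distributive linop_scale +%R.
Proof. by move=> a f g; apply: linop_ext => x /=; rewrite scalerDr. Qed.
Fact linop_scaleDl f : {morph linop_scale^~ f : a b / a + b}.
Proof. by move=> a b; apply: linop_ext => x /=; rewrite scalerDl. Qed.

HB.instance Definition _ := GRing.Zmodule_isLmodule.Build K linop
  linop_scaleA linop_scale1 linop_scaleDr linop_scaleDl.

Fact linop_brDl f g h : linop_br (f + g) h = linop_br f h + linop_br g h.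
Proof.
by apply: linop_ext => x /=; rewrite (linD (linop_linear h)) opprD addrACA.
Qed.
Fact linop_brDr f g h : linop_br f (g + h) = linop_br f g + linop_br f h.
Proof.
by apply: linop_ext => x /=; rewrite (linD (linop_linear f)) opprD addrACA.
Qed.
Fact linop_brZl a f g : linop_br (a *: f) g = a *: linop_br f g.
Proof.
by apply: linop_ext => x /=; rewrite (linZ (linop_linear g)) scalerBr.
Qed.
Fact linop_brZr a f g : linop_br f (a *: g) = a *: linop_br f g.
Proof.
by apply: linop_ext => x /=; rewrite (linZ (linop_linear f)) scalerBr.
Qed.
Fact linop_brxx f : linop_br f f = 0.
Proof. by apply: linop_ext => x /=; rewrite subrr. Qed.
Fact linop_br_jacobi f g h :
  linop_br f (linop_br g h) + linop_br g (linop_br h f)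
  + linop_br h (linop_br f g) = 0.
Proof.
apply: linop_ext => x /=.
rewrite !(linB (linop_linear _)) !opprB !addrA.
rewrite (ACl (1*12*2*7*3*10*4*5*6*11*8*9))%AC /=.
by rewrite !(subrr, addNr, add0r).
Qed.

HB.instance Definition _ := Lmodule_isLieAlg.Build K linop
  linop_brDl linop_brDr linop_brZl linop_brZr linop_brxx linop_br_jacobi.

Lemma linopN f x : (- f) x = - f x. Proof. by []. Qed.
Lemma linopZ a f x : (a *: f) x = a *: f x. Proof. by []. Qed.
Lemma linop0 x : (0 : linop) x = 0. Proof. by []. Qed.
Lemma linop_lieb f g x : [lie f, g] x = f (g x) - g (f x). Proof. by []. Qed.

End LinearOperators.

(** * Chevalley relations and Serre elements *)

Lemma weight_string (K : fieldType) (L : lieAlgType K) (I : Type) (x : L)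
    (e : I -> L) (c : I -> K) (i j : I) (m : nat) :
  (forall k, [lie x, e k] = c k *: e k) ->
  [lie x, iter m (lieb (e i)) (e j)]
  = (c i *+ m + c j) *: iter m (lieb (e i)) (e j).
Proof.
move=> xe; elim: m => [|m IH] /=; first by rewrite xe mulr0n add0r.
rewrite -[LHS](subrK [lie e i, [lie x, iter m (lieb (e i)) (e j)]]).
by rewrite -lieb_leibniz xe IH liebZl liebZr -scalerDl addrA mulrS.
Qed.

Section ChevalleyRelations.
Variables (K : fieldType) (L : lieAlgType K) (n : nat) (A : 'M[int]_n).
Variables e f h : 'I_n -> L.
Hypothesis cartanA : gen_cartan_matrix A.
Hypothesis he : forall i j, [lie h i, e j] = (A i j)%:~R *: e j.
Hypothesis ef : forall i j, [lie e i, f j] = if i == j then h i else 0.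

Lemma lie_fe i j : [lie f i, e j] = if i == j then - h i else 0.
Proof. by rewrite liebC ef eq_sym; case: eqP => [->|_] //; rewrite oppr0. Qed.

Lemma h_string i j m :
  [lie h i, iter m (lieb (e i)) (e j)]
  = (A i j + m.*2%:Z)%:~R *: iter m (lieb (e i)) (e j).
Proof.
rewrite (weight_string (c := fun k => (A i k)%:~R) i j m (he i)).
case: cartanA => -> _ _.
by congr (_ *: _); rewrite mulrnAC -mulrnA muln2 intrD addrC.
Qed.

(** The sl2 computation: moving f_i past each e_i leaves h_i, and its eigenvalues a_ij + 2l for l =
    0..m add up to (m+1)(m + a_ij). This is the factor in the recursion for the Onsager
    coefficients. *)
Lemma f_string i j m : i != j ->
  [lie f i, iter m.+1 (lieb (e i)) (e j)]
  = - (m.+1%:Z * (m%:Z + A i j))%:~R *: iter m (lieb (e i)) (e j).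
Proof.
move=> ij.
have leib x : [lie f i, [lie e i, x]] = [lie e i, [lie f i, x]] - [lie h i, x].
  by rewrite -[RHS]addrC -[[lie f i, _]](subrK [lie e i, [lie f i, x]])
    -lieb_leibniz lie_fe eqxx liebNl.
elim: m => [|m IH].
  by rewrite /= leib lie_fe (negbTE ij) lieb0r he add0r -scaleNr mul1r add0r.
rewrite [iter m.+2 _ _]/= leib IH liebZr -[[lie e i, _]]/(iter m.+1 _ _) h_string.
by rewrite -scalerBl -!mulrNz -intrD; congr (_%:~R *: _); lia.
Qed.

(** For k = i the factor of [f_string] vanishes at the Serre exponent. For k != i, f_k commutes with
    e_i, so only its bracket with e_j matters: zero unless k = j, and then -h_j. *)
Lemma f_serre k i j : i != j ->
  [lie f k, iter (serre_exp A i j) (lieb (e i)) (e j)] = 0.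
Proof.
case: (cartanA) => A2 Ale0 A0 ij.
have [r serreE Ar] : exists2 r, serre_exp A i j = r.+1 & r%:Z = - A i j.
  have := Ale0 _ _ ij; rewrite /serre_exp => Aij.
  by exists `|A i j|%N; lia.
have [->|ki] := eqVneq k i.
  by rewrite serreE f_string // Ar addNr mulr0 oppr0 scale0r.
have comm x : [lie f k, [lie e i, x]] = [lie e i, [lie f k, x]].
  by apply/eqP; rewrite -subr_eq0 -lieb_leibniz lie_fe (negbTE ki) lieb0l.
have commn m x : [lie f k, iter m (lieb (e i)) x] = iter m (lieb (e i)) [lie f k, x].
  by elim: m => //= m <-.
have iter0 m : iter m (lieb (e i)) 0 = 0 by elim: m => //= m ->; rewrite lieb0r.
rewrite commn lie_fe; case: (eqVneq k j) => [->|_]; last exact: iter0.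
have eh : [lie e i, - h j] = (A j i)%:~R *: e i by rewrite liebC liebNl opprK he.
(* One bracket turns -h_j into a_ji e_i. If a_ij = 0 this is zero because a_ji = 0; otherwise a
   second bracket [e_i, e_i] kills it. *)
rewrite serreE iterSr eh; case: r Ar {serreE} => [|r] Ar.
  by rewrite (A0 i j) ?scale0r //; lia.
by rewrite iterSr liebZr liebxx scaler0 iter0.
Qed.

End ChevalleyRelations.

(** * Right-normed words *)

Section Words.
Variables (K : fieldType) (L : lieAlgType K) (I : Type) (b : I -> L).

Fixpoint lie_word (i : I) (s : seq I) : L :=
  if s is j :: s' then [lie b i, lie_word j s'] else b i.

Definition words_at (m : nat) : set L :=
  [set x | exists i s, (size s).+1 = m /\ x = lie_word i s].

Definition word_span (m : nat) : submod L := lspan_submod (words_at m).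

Definition words : set L := [set x | exists i s, x = lie_word i s].

(** By the Leibniz identity, bracketing with a word is a combination of iterated brackets with
    single generators, so the span of the right-normed words is a subalgebra. *)
Lemma generated_words x : lie_generated (range b) x -> lspan words x.
Proof.
pose W : submod L := lspan_submod words.
have bW i y : W y -> W [lie b i, y].
  elim=> {y} [y [j [s ->]]||y z _ ? _ ?|a y _ ?].
  - by apply: lspan_gen; exists i, (j :: s).
  - by rewrite lieb0r; exact: submod0.
  - by rewrite liebDr; exact: submodD.
  - by rewrite liebZr; exact: submodZ.
have wW i s y : W y -> W [lie lie_word i s, y].
  elim: s i y => [|j s IH] i y Wy; first exact: bW.
  by rewrite lieb_leibniz; apply: submodB; [exact/bW/IH|exact/IH/bW].
elim=> {x} [x [i _ <-]||x y _ ? _ ?|a x _ ?|x y _ Wx _ Wy].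
- by apply: lspan_gen; exists i, [::].
- exact: lspan0.
- exact: lspanD.
- exact: lspanZ.
- elim: Wx => {x} [x [j [s ->]]||x z _ ? _ ?|a x _ ?].
  + exact: wW.
  + by rewrite lieb0l; exact: (submod0 W).
  + by rewrite liebDl; exact: (submodD (s := W)).
  + by rewrite liebZl; exact: (submodZ (s := W)).
Qed.

End Words.

Lemma lie_word_hom (K : fieldType) (L L' : lieAlgType K) I (f : L -> L')
    (b : I -> L) i s : lie_hom f ->
  f (lie_word b i s) = lie_word (f \o b) i s.
Proof.
by move=> fH; elim: s i => //= j s IH i; rewrite (lie_hom_lieb fH) IH.
Qed.

(** * Submodules and restricted operators *)

Section SubmodType.
Variables (K : fieldType) (V : lmodType K) (W : submod V).

Definition submod_pred : pred V := fun x => `[< W x >].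

Record submod_type : Type := SubmodElt {
  submod_val : V;
  submod_valP : submod_pred submod_val
}.

HB.instance Definition _ := [isSub for submod_val].
HB.instance Definition _ := [Choice of submod_type by <:].

Fact submod_pred_closed : GRing.subsemimod_closed submod_pred.
Proof.
split; first split.
- by apply/asboolP; exact: submod0.
- by move=> x y /asboolP ? /asboolP ?; apply/asboolP; exact: submodD.
- by move=> a x /asboolP ?; apply/asboolP; exact: submodZ.
Qed.

HB.instance Definition _ :=
  GRing.SubChoice_isSubLmodule.Build K V submod_pred submod_type
    submod_pred_closed.

Lemma submod_val_linear : linear submod_val.
Proof. exact: (linearP (val : submod_type -> V)). Qed.

Lemma submod_valW (x : submod_type) : W (submod_val x).
Proof. by apply/asboolP; exact: submod_valP. Qed.

Lemma submod_val_inj : injective submod_val.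
Proof. exact: (@val_inj _ _ submod_type). Qed.

Definition submod_elt (x : V) (Wx : W x) : submod_type :=
  SubmodElt (asboolT Wx : submod_pred x).

Section Restriction.
Variables (f : linop V) (fW : forall x, W x -> W (f x)).

Definition restrict_fun (x : submod_type) : submod_type :=
  submod_elt (fW (submod_valW x)).

Fact restrict_linear : linear restrict_fun.
Proof.
move=> a x y; apply: submod_val_inj.
rewrite [RHS]submod_val_linear -[LHS]/(f (submod_val (a *: x + y))).
by rewrite submod_val_linear linop_linear.
Qed.

Definition linop_restrict : linop submod_type := LinOp restrict_linear.

End Restriction.

Lemma lie_eval_restrict (X : Type) (g : X -> linop V)
    (gW : X -> linop submod_type) :
  (forall x v, submod_val (gW x v) = g x (submod_val v)) ->
  forall t v, submod_val (lie_eval gW t v) = lie_eval g t (submod_val v).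
Proof.
move=> gWE; elim=> [x||t IHt u IHu|t IHt|a t IHt|t IHt u IHu] v.
- exact: gWE.
- exact: (lin0 submod_val_linear).
- rewrite -[LHS]/(submod_val (lie_eval gW t v + lie_eval gW u v)).
  by rewrite (linD submod_val_linear) IHt IHu.
- rewrite -[LHS]/(submod_val (- lie_eval gW t v)).
  by rewrite (linN submod_val_linear) IHt.
- rewrite -[LHS]/(submod_val (a *: lie_eval gW t v)).
  by rewrite (linZ submod_val_linear) IHt.
- rewrite -[LHS]/(submod_val (lie_eval gW t (lie_eval gW u v)
    - lie_eval gW u (lie_eval gW t v))).
  by rewrite (linB submod_val_linear) IHt IHu IHu IHt.
Qed.

End SubmodType.

(** * Homomorphisms given by their graphs, and induction on n(A) *)

Lemma lie_hom_iter (K : fieldType) (L L' : lieAlgType K) (f : L -> L') x y m :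
  lie_hom f -> f (iter m (lieb x) y) = iter m (lieb (f x)) (f y).
Proof. by move=> fH; elim: m => //= m <-; rewrite (lie_hom_lieb fH). Qed.

(** Since n(A) is given as a subalgebra and not by a presentation, homomorphisms out of it are built
    from graphs; linearity reduces single-valuedness to the fibre over 0. *)
Lemma lie_hom_graph (K : fieldType) (L L' : lieAlgType K)
    (G : L -> L' -> Prop) :
  (forall x, exists y, G x y) -> (forall y, G 0 y -> y = 0) ->
  (forall a x x' y y', G x y -> G x' y' -> G (a *: x + x') (a *: y + y')) ->
  (forall x x' y y', G x y -> G x' y' -> G [lie x, x'] [lie y, y']) ->
  exists2 f : L -> L', lie_hom f & forall x y, G x y <-> f x = y.
Proof.
move=> Gtot G0 Glin Gbr; have [f Gf] := choice Gtot.
have Guniq x y y' : G x y -> G x y' -> y = y'.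
  move=> xy xy'; have := Glin (-1) _ _ _ _ xy' xy; rewrite !scaleN1r addNr.
  by move=> /G0/eqP; rewrite addrC subr_eq0 => /eqP.
exists f; last by move=> x y; split=> [xy|<- //]; exact: Guniq (Gf x) xy.
split=> [a x y|x y].
  exact: Guniq (Gf _) (Glin _ _ _ _ _ (Gf x) (Gf y)).
exact: Guniq (Gf _) (Gbr _ _ _ _ (Gf x) (Gf y)).
Qed.

Lemma km_n_ind (K : fieldType) n (A : 'M[int]_n) (rz : realization K A)
    (P : km_n rz -> Prop) :
  (forall i, P (km_n_e rz i)) -> P 0 ->
  (forall x y, P x -> P y -> P (x + y)) ->
  (forall a x, P x -> P (a *: x)) ->
  (forall x y, P x -> P y -> P [lie x, y]) -> forall x, P x.
Proof.
move=> Pe P0 PD PZ PB w.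
have /asboolP : subalg_pred (km_n_subalg rz) (subalg_val w) by exact: subalg_valP.
(* Generation is a predicate on g(A), so the induction runs over the underlying element, for every
   lift of it to [km_n]. *)
rewrite /=; move: (erefl (subalg_val w)); move: {1 3}(subalg_val w) => x + gx.
elim: gx w => {x} [x [i _ <-]||x y gx IHx gy IHy|a x gx IHx|x y gx IHx gy IHy] z /esym zE.
- by rewrite (_ : z = km_n_e rz i) //; exact: subalg_val_inj.
- by rewrite (_ : z = 0) //; apply: subalg_val_inj; rewrite zE subalg_val0.
- pose x' : km_n rz := @subalg_elt _ _ (km_n_subalg rz) x gx.
  pose y' : km_n rz := @subalg_elt _ _ (km_n_subalg rz) y gy.
  rewrite (_ : z = x' + y'); first by apply: PD; [exact: IHx|exact: IHy].
  by apply: subalg_val_inj; rewrite zE subalg_valD.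
- pose x' : km_n rz := @subalg_elt _ _ (km_n_subalg rz) x gx.
  rewrite (_ : z = a *: x'); first by apply: PZ; exact: IHx.
  by apply: subalg_val_inj; rewrite zE subalg_valZ.
- pose x' : km_n rz := @subalg_elt _ _ (km_n_subalg rz) x gx.
  pose y' : km_n rz := @subalg_elt _ _ (km_n_subalg rz) y gy.
  rewrite (_ : z = [lie x', y']); first by apply: PB; [exact: IHx|exact: IHy].
  by apply: subalg_val_inj; rewrite zE.
Qed.

(** * The coinduced module *)

Section CoinducedModule.
Variables (K : fieldType) (n : nat) (A : 'M[int]_n) (rz : realization K A).
Hypothesis cartanA : gen_cartan_matrix A.
Variable M : lmodType K.

Local Notation h := (rz_h rz).
Local Notation alpha := (rz_root rz).
Local Notation coroot := (rz_coroot rz).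
Local Notation V := (seq 'I_n -> M).

Definition word_weight (s : seq 'I_n) (x : h) : K := \sum_(j <- s) (alpha j x : K).

(* A function of words is a functional on the free algebra on the e_i, with     *)
(* values in [M]; the head of the list is the rightmost letter, and g acts by    *)
(* right multiplication on 1 (x)_(U(b-)) U(g), where b- acts trivially on 1.     *)
Definition coind_e_fun (i : 'I_n) (phi : V) : V := fun s => phi (i :: s).

(** Moving [x] to the left through the word, to where it acts by zero, leaves minus the weight of
    the word. *)
Definition coind_h_fun (x : h) (phi : V) : V :=
  fun s => - word_weight s x *: phi s.

(** The recursion is e_j f_i = f_i e_j + delta_ij h_i, applied to the rightmost letter until f_i
    reaches the left end, where it acts by zero. *)
Fixpoint coind_f_rec (i : 'I_n) (s : seq 'I_n) (phi : V) : M :=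
  if s is j :: s' then
    coind_f_rec i s' (coind_e_fun j phi)
    + (if i == j then coind_h_fun (coroot i) phi s' else 0)
  else 0.

Definition coind_f_fun (i : 'I_n) (phi : V) : V := fun s => coind_f_rec i s phi.

Fact coind_e_linear i : linear (coind_e_fun i).
Proof. by []. Qed.

Fact coind_h_linear x : linear (coind_h_fun x).
Proof.
move=> a phi psi; apply/funext => s; rewrite /coind_h_fun.
rewrite -[(a *: phi + psi) s]/(a *: phi s + psi s).
by rewrite scalerDr scalerA mulrC -scalerA.
Qed.

Fact coind_f_linear i : linear (coind_f_fun i).
Proof.
move=> a phi psi; apply/funext => s.
rewrite -[RHS]/(a *: coind_f_rec i s phi + coind_f_rec i s psi) /coind_f_fun.
elim: s phi psi => [|j s IH] phi psi /=; first by rewrite scaler0 addr0.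
rewrite coind_e_linear IH; case: eqP => _; last by rewrite !addr0.
rewrite coind_h_linear -[(_ *: _ + _) s]/(a *: coind_h_fun (coroot i) phi s
  + coind_h_fun (coroot i) psi s).
by rewrite scalerDr addrACA.
Qed.

Definition coind_e i : linop V := LinOp (coind_e_linear i).
Definition coind_h x : linop V := LinOp (coind_h_linear x).
Definition coind_f i : linop V := LinOp (coind_f_linear i).

Lemma coind_he x j : [lie coind_h x, coind_e j] = (alpha j x : K) *: coind_e j.
Proof.
apply: linop_ext => phi; apply/funext => s.
rewrite -[RHS]/((alpha j x : K) *: phi (j :: s)).
rewrite -[LHS]/(- word_weight s x *: phi (j :: s)
  - - word_weight (j :: s) x *: phi (j :: s)).
rewrite /word_weight big_cons -scalerBl opprK addrC -addrA subrr addr0.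
by [].
Qed.

Lemma coind_ef i j :
  [lie coind_e i, coind_f j] = if i == j then coind_h (coroot i) else 0.
Proof.
apply: linop_ext => phi; apply/funext => s; rewrite linop_lieb /=.
rewrite -[LHS]/(coind_f_rec j s (coind_e_fun i phi)
  + (if j == i then coind_h_fun (coroot j) phi s else 0)
  - coind_f_rec j s (coind_e_fun i phi)).
by rewrite addrAC subrr add0r eq_sym; case: eqP => [->|_].
Qed.

Lemma coind_hh x y : [lie coind_h x, coind_h y] = 0.
Proof.
apply: linop_ext => phi; apply/funext => s; rewrite linop_lieb /=.
rewrite -[LHS]/(- word_weight s x *: (- word_weight s y *: phi s)
  - (- word_weight s y *: (- word_weight s x *: phi s))).
by rewrite !scalerA mulrC subrr.
Qed.

Lemma coind_hf x j : [lie coind_h x, coind_f j] = - (alpha j x : K) *: coind_f j.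
Proof.
apply: linop_ext => phi; apply/funext => s; rewrite linop_lieb.
rewrite -[LHS]/(- word_weight s x *: coind_f_rec j s phi
  - coind_f_rec j s (coind_h x phi)).
rewrite -[RHS]/(- (alpha j x : K) *: coind_f_rec j s phi).
elim: s phi => [|k s IH] phi /=; first by rewrite !scaler0 subrr.
have -> : coind_e_fun k (coind_h_fun x phi)
    = - (alpha k x : K) *: coind_e_fun k phi + coind_h x (coind_e_fun k phi).
  apply/funext => t.
  rewrite -[RHS]/(- (alpha k x : K) *: phi (k :: t)
    + - word_weight t x *: phi (k :: t)).
  by rewrite -scalerDl -opprD -[LHS]/(- word_weight (k :: t) x *: phi (k :: t))
    /word_weight big_cons.
have fE a p q :
    coind_f_rec j s (a *: p + q) = a *: coind_f_rec j s p + coind_f_rec j s q.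
  exact: (congr1 (fun f => f s) (coind_f_linear j a p q)).
rewrite fE.
set F := coind_f_rec j s (coind_e_fun k phi).
have -> : coind_f_rec j s (coind_h x (coind_e_fun k phi))
    = - word_weight s x *: F + (alpha j x : K) *: F.
  apply/eqP; rewrite -[_ *: F in X in _ + X]opprK -scaleNr -(IH (coind_e_fun k phi)).
  by rewrite opprB addrC subrK.
have wE : word_weight (k :: s) x = (alpha k x : K) + word_weight s x.
  by rewrite /word_weight big_cons.
move: (word_weight (k :: s) x) wE => w wE.
move: F => F; case: eqP => [jk|_]; last first.
  rewrite !addr0 -!scalerDl -scalerBl wE; congr (_ *: _); ring.
rewrite -jk /coind_h_fun !scalerDr !scalerA opprD addrACA -!scalerDl -!scalerBl.
by rewrite wE -jk; congr (_ *: _ + _ *: _); ring.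
Qed.

(* An iterated commutator of the [f_i] commuting with every [e_k] is zero: its   *)
(* image vanishes at the empty word, as that of each [f_i] does.                 *)
Lemma coind_serre_f i j : i != j ->
  iter (serre_exp A i j) (lieb (coind_f i)) (coind_f j) = 0.
Proof.
move=> ij; set T := iter _ _ _.
have Te k : [lie coind_e k, T] = 0.
  (* The roles of e and f are exchanged, which replaces the Cartan elements h_i by -h_i. *)
  apply: (@f_serre _ _ _ _ coind_f coind_e (fun i => - coind_h (coroot i))) => //.
  - by move=> a b; rewrite liebNl coind_hf rz_pairing scaleNr opprK.
  - move=> a b; rewrite liebC coind_ef eq_sym.
    by case: eqP => [->|_] //; rewrite oppr0.
have T0 phi : T phi [::] = 0.
  rewrite /T; elim: (serre_exp A i j) phi => [//|m IH] phi.
  by rewrite -[LHS]/(0 - iter m (lieb (coind_f i)) (coind_f j) (coind_f i phi) [::])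
    IH subr0.
apply: linop_ext => phi; apply/funext => s; rewrite linop0.
elim: s phi => [|k s IH] phi; first exact: T0.
have /eqP := congr1 (fun f : linop V => f phi) (Te k).
rewrite linop_lieb subr_eq0 => /eqP/(congr1 (fun g : V => g s)).
by rewrite IH.
Qed.

Definition coind_theta (i j : 'I_n) : linop V :=
  iter (serre_exp A i j) (lieb (coind_e i)) (coind_e j).

Definition coind_word (s : seq 'I_n) (phi : V) : V :=
  foldl (fun psi i => coind_e i psi) phi s.

(** The largest subspace stable under the [coind_e i] and killed by the Serre elements; on all of
    [V] the [coind_e i] need not satisfy the Serre relations. *)
Definition serre_null : set V :=
  [set phi | forall i j, i != j -> forall s,
     coind_theta i j (coind_word s phi) = 0].

Lemma coind_word_linear s : linear (coind_word s).
Proof. by elim: s => //= i s IH a phi psi; rewrite -IH. Qed.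

Fact serre_null0 : serre_null 0.
Proof.
by move=> i j ij s; rewrite (lin0 (coind_word_linear s)) (lin0 (linop_linear _)).
Qed.

Fact serre_nullD phi psi :
  serre_null phi -> serre_null psi -> serre_null (phi + psi).
Proof.
move=> phi0 psi0 i j ij s.
by rewrite (linD (coind_word_linear s)) (linD (linop_linear _)) phi0
  // psi0 // addr0.
Qed.

Fact serre_nullZ a phi : serre_null phi -> serre_null (a *: phi).
Proof.
move=> phi0 i j ij s.
by rewrite (linZ (coind_word_linear s)) (linZ (linop_linear _)) phi0
  // scaler0.
Qed.

Definition coind : submod V := Submod serre_null0 serre_nullD serre_nullZ.

Lemma coind_e_null i phi : coind phi -> coind (coind_e i phi).
Proof. by move=> phi0 j k jk s; exact: (phi0 j k jk (i :: s)). Qed.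

Lemma linop_comm_sub (f g : linop V) phi : f (g phi) = g (f phi) + [lie f, g] phi.
Proof. by rewrite linop_lieb addrC subrK. Qed.

Lemma coind_h_null x phi : coind phi -> coind (coind_h x phi).
Proof.
move=> phi0 i j ij s.
elim: s phi phi0 => [|k s IH] phi phi0.
  rewrite -[coind_word _ _]/(coind_h x phi) linop_comm_sub liebC /coind_theta.
  rewrite (weight_string (c := fun k => alpha k x : K) i j _ (coind_he x)).
  rewrite linopN linopZ -/(coind_theta i j) (phi0 i j ij [::]) scaler0 oppr0.
  by rewrite (lin0 (linop_linear _)) addr0.
rewrite -[coind_word _ _]/(coind_word s (coind_e k (coind_h x phi))).
rewrite linop_comm_sub liebC coind_he linopN linopZ.
rewrite (linB (coind_word_linear s)) (linB (linop_linear _)).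
rewrite (linZ (coind_word_linear s)) (linZ (linop_linear _)).
rewrite IH; last exact: coind_e_null.
by rewrite sub0r (phi0 i j ij (k :: s)) scaler0 oppr0.
Qed.

(** [coind_f k] commutes with the Serre elements by [f_serre], and its commutators with the
    [coind_e l] are Cartan operators, which preserve the subspace by [coind_h_null]. *)
Lemma coind_f_null k phi : coind phi -> coind (coind_f k phi).
Proof.
move=> phi0 i j ij s.
elim: s phi phi0 => [|l s IH] phi phi0.
  rewrite -[coind_word _ _]/(coind_f k phi) linop_comm_sub liebC.
  rewrite (f_serre (h := fun i => coind_h (coroot i)) cartanA) //.
  - by rewrite oppr0 addr0 (phi0 i j ij [::]) (lin0 (linop_linear _)).
  - by move=> a b; rewrite coind_he rz_pairing.
  - exact: coind_ef.
rewrite -[coind_word _ _]/(coind_word s (coind_e l (coind_f k phi))).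
rewrite linop_comm_sub coind_ef.
rewrite (linD (coind_word_linear s)) (linD (linop_linear _)).
rewrite IH ?add0r; last exact: coind_e_null.
case: eqP => _; first exact: coind_h_null.
by rewrite (lin0 (coind_word_linear s)) (lin0 (linop_linear _)).
Qed.

Definition coind_gen (g : km_generator rz) : linop V :=
  match g with
  | KMh x => coind_h x
  | KMe i => coind_e i
  | KMf i => coind_f i
  end.

Fact coind_gen_null g phi : coind phi -> coind (coind_gen g phi).
Proof.
by case: g => [x|i|i]; [exact: coind_h_null|exact: coind_e_null|exact: coind_f_null].
Qed.

Definition coind_act (g : km_generator rz) : linop (submod_type coind) :=
  linop_restrict (@coind_gen_null g).

Lemma coind_act_rel t u : km_rel t u ->
  lie_eval coind_act t = lie_eval coind_act u.
Proof.
move=> tu; apply: linop_ext => v; apply: submod_val_inj.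
rewrite !(@lie_eval_restrict _ _ _ _ coind_gen) //.
have := submod_valW v; move: (submod_val v) => {v} phi phi0.
case: tu => [a x y|x y|x j|x j|i j|i j ij|i j ij].
- apply/funext => s; rewrite -[RHS]/(a *: (- word_weight s x *: phi s)
    + - word_weight s y *: phi s).
  rewrite scalerA -scalerDl; congr (_ *: _); rewrite mulrN -opprD; congr (- _).
  rewrite /word_weight mulr_sumr -big_split /=; apply: eq_bigr => k _.
  by rewrite linearP.
- exact: (congr1 (fun f : linop V => f phi) (coind_hh x y)).
- exact: (congr1 (fun f : linop V => f phi) (coind_he x j)).
- exact: (congr1 (fun f : linop V => f phi) (coind_hf x j)).
- have := congr1 (fun f : linop V => f phi) (coind_ef i j).
  by case: eqP.
- by rewrite lie_eval_iter; exact: (phi0 i j ij [::]).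
- by rewrite lie_eval_iter coind_serre_f.
Qed.

Definition coind_rep : kac_moody rz -> linop (submod_type coind) :=
  pres_lift (rel := km_rel (rz := rz)) coind_act.

Lemma coind_rep_hom : lie_hom coind_rep.
Proof. exact: pres_lift_hom coind_act_rel. Qed.

Section Operators.
Variable beta : 'I_n -> linop M.
Hypothesis beta_serre : forall i j, i != j ->
  iter (serre_exp A i j) (lieb (beta i)) (beta j) = 0.

(** The functional u |-> u m on the free algebra acting through [beta]. Since [coind_e i] sends it
    to the functional of [beta i m], this embeds [M] equivariantly for the e_i. *)
Definition orbit_map (m : M) : V := fun s => foldl (fun x i => beta i x) m s.

Lemma orbit_map_linear : linear orbit_map.
Proof.
move=> a x y; apply/funext => s.
rewrite -[RHS]/(a *: orbit_map x s + orbit_map y s) /orbit_map.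
by elim: s x y => //= i s IH x y; rewrite linop_linear IH.
Qed.

Lemma orbit_map_null m : coind (orbit_map m).
Proof.
move=> i j ij s.
have -> : coind_word s (orbit_map m) = orbit_map (foldl (fun x i => beta i x) m s).
  by elim: s m => //= k s IH m; rewrite -IH.
move: (foldl _ _ _) => x.
suff TE k : iter k (lieb (coind_e i)) (coind_e j) (orbit_map x)
    = orbit_map (iter k (lieb (beta i)) (beta j) x).
  by rewrite /coind_theta TE beta_serre // (lin0 orbit_map_linear).
elim: k x => [//|k IH] x.
rewrite -[LHS]/(coind_e i (iter k (lieb (coind_e i)) (coind_e j) (orbit_map x))
  - iter k (lieb (coind_e i)) (coind_e j) (orbit_map (beta i x))) !IH.
by rewrite [iter k.+1 _ _]/= linop_lieb (linB orbit_map_linear).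
Qed.

Definition orbit (m : M) : submod_type coind := submod_elt (orbit_map_null m).

Lemma orbit_linear : linear orbit.
Proof.
move=> a x y; apply: submod_val_inj; rewrite submod_val_linear.
exact: orbit_map_linear.
Qed.

Lemma orbit_inj : injective orbit.
Proof.
by move=> x y /(congr1 (@submod_val _ _ _))/(congr1 (fun f : V => f [::])).
Qed.

(** The e_i preserve the copy [orbit] of [M] and act there by [beta i], so all of n(A) preserves it.
    The graph [G] relates an element to the operator it induces, which is unique because [orbit] is
    injective. *)
Lemma km_n_operators :
  exists2 rho : km_n rz -> linop M, lie_hom rho &
    forall i, rho (km_n_e rz i) = beta i.
Proof.
pose G (y : km_n rz) (T : linop M) :=
  forall m, coind_rep (subalg_val y) (orbit m) = orbit (T m).
have [repL repB] := coind_rep_hom.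
have Ge i : G (km_n_e rz i) (beta i).
  move=> m; rewrite /= /coind_rep /km_e pres_lift_gen; last exact: coind_act_rel.
  exact: submod_val_inj.
have Glin a x x' y y' : G x y -> G x' y' -> G (a *: x + x') (a *: y + y').
  move=> xy xy' m.
  by rewrite subalg_valD subalg_valZ repL orbit_linear -xy -xy'.
have Gbr x x' y y' : G x y -> G x' y' -> G [lie x, x'] [lie y, y'].
  move=> xy xy' m; rewrite subalg_val_br repB linop_lieb xy' xy xy xy'.
  by rewrite -(linB orbit_linear).
have G00 : G 0 0.
  move=> m; rewrite subalg_val0 (lin0 repL) linop0.
  by rewrite (lin0 orbit_linear).
have [//|y Gy|rho rhoH rhoE] := lie_hom_graph _ _ Glin Gbr.
- elim/km_n_ind => [i||x y [T xT] [U yU]|a x [T xT]|x y [T xT] [U yU]].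
  + by exists (beta i).
  + by exists 0.
  + by exists (1 *: T + U); rewrite -[x]scale1r; exact: Glin.
  + by exists (a *: T + 0); rewrite -[a *: x]addr0; exact: Glin.
  + by exists [lie T, U]; exact: Gbr.
- apply: linop_ext => m; apply: orbit_inj; rewrite -Gy.
  by rewrite -G00.
by exists rho => // i; apply/rhoE/Ge.
Qed.

End Operators.

End CoinducedModule.

(** * The degree element and homomorphisms from n(A) to a graded Lie algebra *)

Lemma realization_degree_element (K : fieldType) n (A : 'M[int]_n)
    (rz : realization K A) :
  exists x : rz_h rz, forall i, rz_root rz i x = 1 :> K.
Proof.
pose b := vbasis {: rz_h rz}.
pose P := \matrix_(i < n, k < \dim {: rz_h rz}) (rz_root rz i b`_k : K).
(* Independence of the roots gives [P] a right inverse [B]; the coordinates wanted are [B] times the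
   all-ones vector. *)
suff /row_freeP[B PB] : row_free P.
  exists (\sum_k (B *m (const_mx 1 : 'cV_n)) k 0 *: b`_k) => i.
  transitivity ((P *m (B *m (const_mx 1 : 'cV_n))) i 0); last first.
    by rewrite mulmxA PB mul1mx mxE.
  rewrite linear_sum [RHS]mxE; apply: eq_bigr => k _.
  by rewrite linearZ [P i k]mxE mulrC.
rewrite -kermx_eq0; apply/rowV0P => u /sub_kermxP uP0.
pose X := [tuple rz_root rz i | i < n].
have freeX : free X.
  rewrite (_ : X = codom (rz_root rz) :> seq _); first exact: rz_root_free.
  by rewrite codomE.
have /freeP/(_ (fun i => u 0 i)) := freeX.
have -> : \sum_(i < n) u 0 i *: X`_i = \sum_i u 0 i *: rz_root rz i.
  by apply: eq_bigr => i _; rewrite -tnth_nth tnth_mktuple.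
move=> u0; apply/rowP => i; rewrite mxE; apply: u0.
apply/lfunP => x; rewrite zero_lfunE sum_lfunE.
rewrite (coord_vbasis (memvf x)) -/b.
under eq_bigr => j _.
  rewrite scale_lfunE linear_sum scaler_sumr.
  over.
rewrite exchange_big big1 //= => k _.
have /rowP/(_ k) := uP0; rewrite !mxE => uk.
transitivity (coord b k x * \sum_j u 0 j * P j k); last first.
  by rewrite uk mulr0.
rewrite mulr_sumr; apply: eq_bigr => j _.
by rewrite linearZ [P j k]mxE /= mulrCA.
Qed.

Section GradedTarget.
Variables (K : fieldType) (n : nat) (A : 'M[int]_n) (rz : realization K A).
Hypothesis cartanA : gen_cartan_matrix A.
Variables (G : lieAlgType K) (D : G -> G) (b : 'I_n -> G).
Hypothesis D_linear : linear D.
Hypothesis D_inj : injective D.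
Hypothesis D_deriv : forall x y, D [lie x, y] = [lie D x, y] + [lie x, D y].
Hypothesis D_b : forall i, D (b i) = b i.
Hypothesis b_serre : forall i j, i != j ->
  iter (serre_exp A i j) (lieb (b i)) (b j) = 0.

(* The adjoint action of [G] on the semidirect product [G + K D], twisted by    *)
(* -1 on the second summand; it is faithful because [D] is injective.           *)
Definition semidirect_ad_fun (g : G) (m : G * K^o) : G * K^o :=
  ([lie g, m.1] + (m.2 : K) *: D g, 0).

Fact semidirect_ad_linear g : linear (semidirect_ad_fun g).
Proof.
move=> a [x c] [y d]; congr (_, _); rewrite /= ?scaler0 ?addr0 //.
by rewrite liebDr liebZr scalerDl -scalerA scalerDr addrACA.
Qed.

Definition semidirect_ad g : linop (G * K^o)%type := LinOp (semidirect_ad_linear g).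

Lemma semidirect_ad_hom : lie_hom semidirect_ad.
Proof.
split=> [a x y|x y]; apply: linop_ext => -[z c]; congr (_, _) => /=.
- rewrite liebDl liebZl D_linear scalerDr scalerA (mulrC c) -scalerA.
  by rewrite scalerDr addrACA.
- by rewrite scaler0 addr0.
- rewrite !scale0r !addr0 lieb_leibniz D_deriv !liebDr !liebZr.
  rewrite opprD addrACA; congr (_ + _).
  by rewrite scalerDr addrC -scalerN -liebC.
- by rewrite subrr.
Qed.

Lemma semidirect_ad_inj : injective semidirect_ad.
Proof.
move=> x y /(congr1 (fun f : linop _ => (f (0, 1)).1)).
by rewrite /= !lieb0r !add0r !scale1r => /D_inj.
Qed.

(** The operators [semidirect_ad (b i)] satisfy the Serre relations, so n(A) acts through them; all
    the resulting operators come from [G], and faithfulness pulls the action back to a map into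
    [G]. *)
Lemma km_n_graded_hom :
  exists2 phi : km_n rz -> G, lie_hom phi & forall i, phi (km_n_e rz i) = b i.
Proof.
have [adL adB] := semidirect_ad_hom.
have [i j ij|rho [rhoL rhoB] rho_e] :=
    km_n_operators rz cartanA (beta := fun i => semidirect_ad (b i)).
  by rewrite -lie_hom_iter ?b_serre ?(lin0 adL) //; exact: semidirect_ad_hom.
pose R (y : km_n rz) g := rho y = semidirect_ad g.
have Rlin a x x' y y' : R x y -> R x' y' -> R (a *: x + x') (a *: y + y').
  by rewrite /R rhoL adL => -> ->.
have Rbr x x' y y' : R x y -> R x' y' -> R [lie x, x'] [lie y, y'].
  by rewrite /R rhoB adB => -> ->.
have R00 : R 0 0 by rewrite /R (lin0 rhoL) (lin0 adL).
have [|y Ry|phi phiH phiE] := lie_hom_graph _ _ Rlin Rbr.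
- elim/km_n_ind => [i||x y [T xT] [U yU]|a x [T xT]|x y [T xT] [U yU]].
  + by exists (b i); exact: rho_e.
  + by exists 0.
  + by exists (1 *: T + U); rewrite -[x]scale1r; exact: Rlin.
  + by exists (a *: T + 0); rewrite -[a *: x]addr0; exact: Rlin.
  + by exists [lie T, U]; exact: Rbr.
- by apply: semidirect_ad_inj; rewrite -Ry R00.
by exists phi => // i; apply/phiE/rho_e.
Qed.

(** [phi] intertwines ad(x0) with [D], since both are derivations fixing the generators. *)
Lemma km_n_hom_eigen (phi : km_n rz -> G) (x0 : rz_h rz) (k : K) (y : km_n rz) :
  lie_hom phi -> (forall i, phi (km_n_e rz i) = b i) ->
  (forall i, rz_root rz i x0 = 1 :> K) ->
  [lie km_h x0, subalg_val y] = k *: subalg_val y -> D (phi y) = k *: phi y.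
Proof.
move=> [phiL phiB] phi_e x0E.
have [z zE ->] : exists2 z : km_n rz,
    subalg_val z = [lie km_h x0, subalg_val y] & D (phi y) = phi z.
  elim/km_n_ind: y => [i||x y [z zE zD] [w wE wD]|a x [z zE zD]|
      x y [z zE zD] [w wE wD]].
  - by exists (km_n_e rz i); rewrite ?phi_e //= km_he x0E scale1r.
  - by exists 0; rewrite ?subalg_val0 ?lieb0r // (lin0 phiL) (lin0 D_linear).
  - exists (z + w); first by rewrite !subalg_valD liebDr zE wE.
    by rewrite !(linD phiL) (linD D_linear) zD wD.
  - exists (a *: z); first by rewrite !subalg_valZ liebZr zE.
    by rewrite !(linZ phiL) (linZ D_linear) zD.
  - exists ([lie z, y] + [lie x, w]); last first.
      by rewrite (linD phiL) !phiB D_deriv zD wD.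
    rewrite subalg_valD !subalg_val_br zE wE lieb_leibniz.
    by rewrite -addrA addNr addr0.
rewrite -subalg_valZ => E; rewrite -(linZ phiL); congr phi.
by apply: subalg_val_inj; rewrite zE E.
Qed.

End GradedTarget.

(** * Eigenspaces of an inner derivation *)

Section Eigenvalues.
Variables (K : fieldType) (L : lieAlgType K) (x0 : L).
Hypothesis charK : [pchar K] =i pred0.

Definition eigen_at (k : int) : set L := [set y | [lie x0, y] = k%:~R *: y].

Definition eigen_below (m : int) : submod L :=
  lspan_submod [set y | exists2 k : int, k < m & eigen_at k y].

Lemma eigen_below_sub k m y : k <= m -> eigen_below k y -> eigen_below m y.
Proof.
move=> km; elim=> {y} [y [l lk yl]||x y _ ? _ ?|a x _ ?].
- by apply: lspan_gen; exists l => //; exact: lt_le_trans km.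
- exact: submod0.
- exact: submodD.
- exact: submodZ.
Qed.

Lemma eigen_at_below k m y : k < m -> eigen_at k y -> eigen_below m y.
Proof. by move=> km ky; apply: lspan_gen; exists k. Qed.

Lemma eigen_atB k l x y : eigen_at k x -> eigen_at l y -> eigen_at (k + l) [lie x, y].
Proof.
rewrite /eigen_at /= => xk yl; rewrite intrD scalerDl -!liebZl.
by rewrite -(subrK [lie x, [lie x0, y]] [lie x0, _]) -lieb_leibniz xk yl liebZr liebZl
  liebZl.
Qed.

Lemma eigen_belowB k m x y :
  eigen_at k x -> eigen_below m y -> eigen_below (k + m) [lie x, y].
Proof.
move=> xk; elim=> {y} [y [l lm yl]||z y _ ? _ ?|a z _ ?].
- by apply: eigen_at_below (eigen_atB xk yl); rewrite ltrD2l.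
- by rewrite lieb0r; exact: submod0.
- by rewrite liebDr; exact: submodD.
- by rewrite liebZr; exact: submodZ.
Qed.

Let shift (k : int) (z : L) : L := [lie x0, z] - k%:~R *: z.
Let shifts (ks : seq int) (y : L) : L := foldr shift y ks.

Let shifts0 ks : shifts ks 0 = 0.
Proof. by elim: ks => //= k ks ->; rewrite /shift lieb0r scaler0 subr0. Qed.

Let shiftsD ks y z : shifts ks (y + z) = shifts ks y + shifts ks z.
Proof.
by elim: ks => //= k ks ->; rewrite /shift liebDr scalerDr opprD addrACA.
Qed.

Let shiftsZ ks a y : shifts ks (a *: y) = a *: shifts ks y.
Proof.
by elim: ks => //= k ks ->; rewrite /shift liebZr scalerBr !scalerA mulrC.
Qed.

Let shiftC k l z : shift k (shift l z) = shift l (shift k z).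
Proof.
rewrite /shift !liebBr !liebZr !scalerBr !scalerA !opprD !opprK -!addrA.
by congr (_ + _); rewrite addrCA mulrC.
Qed.

Let shift_shifts k ks y : shift k (shifts ks y) = shifts ks (shift k y).
Proof. by elim: ks => //= l ks <-; rewrite shiftC. Qed.

Let shiftsC ks ls y : shifts ks (shifts ls y) = shifts ls (shifts ks y).
Proof. by elim: ks => //= k ks ->; rewrite shift_shifts. Qed.

(** Some product of operators ad(x0) - k with k < m kills [y], yet it multiplies [y] by the product
    of the m - k, which is nonzero in characteristic zero. *)
Lemma eigen_at_below0 m y : eigen_at m y -> eigen_below m y -> y = 0.
Proof.
move=> ym yb.
have [ks ksm ks0] : exists2 ks : seq int, all (fun k => k < m) ks & shifts ks y = 0.
  elim: yb {ym} => {y} [y [k km yk]||x y _ [ks ksm ks0] _ [ls lsm ls0]|a x _ [ks ksm ks0]].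
  - by exists [:: k]; rewrite /= ?km // /shift yk subrr.
  - by exists [::].
  - exists (ks ++ ls); first by rewrite all_cat ksm.
    rewrite /shifts foldr_cat -![foldr _ _ _]/(shifts _ _).
    by rewrite shiftsD ls0 addr0 shiftsC ks0 shifts0.
  - by exists ks; rewrite // shiftsZ ks0 scaler0.
have nz : \prod_(k <- ks) (m - k)%:~R != 0 :> K.
  rewrite prodf_seq_neq0; apply/allP => k /(allP ksm) /= km.
  have [d ->] : exists d : nat, m - k = d.+1%:Z by exists `|m - k|.-1%N; lia.
  by have /pcharf0P -> := charK.
suff E : shifts ks y = (\prod_(k <- ks) (m - k)%:~R) *: y.
  by apply/eqP; move/eqP: ks0; rewrite E scaler_eq0 (negbTE nz).
elim: ks {ksm ks0 nz} => [|k ks IH]; first by rewrite big_nil scale1r.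
rewrite /= IH big_cons /shift liebZr ym !scalerA -scalerBl.
by congr (_ *: _); rewrite intrB mulrBl mulrC.
Qed.

End Eigenvalues.

(** * Filtration by word length *)

Section WordFiltration.
Variables (K : fieldType) (L : lieAlgType K) (I : Type) (b : I -> L).

Definition words_upto (m : nat) : set L :=
  [set x | exists i s, ((size s).+1 <= m)%N /\ x = lie_word b i s].

Definition word_fil (m : nat) : submod L := lspan_submod (words_upto m).

Lemma word_fil_sub m m' x : (m <= m')%N -> word_fil m x -> word_fil m' x.
Proof.
move=> mm; elim=> {x} [x [k [s [ks ->]]]||x y _ ? _ ?|a x _ ?].
- by apply: lspan_gen; exists k, s; split=> //; exact: leq_trans ks mm.
- exact: submod0.
- exact: submodD.
- exact: submodZ.
Qed.

Lemma word_fil_word i s m : (size s < m)%N -> word_fil m (lie_word b i s).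
Proof. by move=> sm; apply: lspan_gen; exists i, s. Qed.

Lemma word_fil_lieb i m x : word_fil m x -> word_fil m.+1 [lie b i, x].
Proof.
elim=> {x} [x [k [s [ks ->]]]||x y _ ? _ ?|a x _ ?].
- by apply: lspan_gen; exists i, (k :: s).
- by rewrite lieb0r; exact: submod0.
- by rewrite liebDr; exact: submodD.
- by rewrite liebZr; exact: submodZ.
Qed.

Lemma word_fil_exhaustive x : lspan (words b) x -> exists m, word_fil m x.
Proof.
elim=> {x} [x [i [s ->]]||x y _ [m mx] _ [k ky]|a x _ [m mx]].
- by exists (size s).+1; exact: word_fil_word.
- by exists 0%N; exact: submod0.
- exists (maxn m k); apply: submodD.
    by apply: word_fil_sub mx; exact: leq_maxl.
  by apply: word_fil_sub ky; exact: leq_maxr.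
- by exists m; exact: submodZ.
Qed.

Lemma word_fil_words m x : word_fil m x -> lspan (words b) x.
Proof.
elim=> {x} [x [k [s [_ ->]]]||x y _ ? _ ?|a x _ ?].
- by apply: lspan_gen; exists k, s.
- exact: lspan0.
- exact: lspanD.
- exact: lspanZ.
Qed.

End WordFiltration.

Lemma subalg_val_hom (K : fieldType) (L : lieAlgType K) (S : lie_subalg L) :
  lie_hom (@subalg_val _ _ S).
Proof. by split=> // a x y; rewrite subalg_valD subalg_valZ. Qed.

Lemma onsager_coef_gt a r s : (r < s)%N -> onsager_coef a r s = 0.
Proof.
case: r s => [|[|r]] [|[|s]] //=.
by move=> rs; rewrite gtn_eqF // ifT //; lia.
Qed.

(** The recursion persists at the two top indices, where it reads 0 = 0 and 1 = 1, so it can be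
    summed over all s at once. *)
Lemma onsager_coef_recS a r s : (s <= r.+2)%N ->
  onsager_coef a r.+2 s =
    (if s is s1.+1 then onsager_coef a r.+1 s1 else 0)
    - r.+1%:Z * (r%:Z + a) * onsager_coef a r s.
Proof.
rewrite leq_eqVlt => /predU1P[->|].
  by rewrite !onsager_coef_diag onsager_coef_gt // mulr0 subr0.
rewrite ltnS leq_eqVlt => /predU1P[->|]; last by rewrite ltnS => /onsager_coef_rec.
by rewrite !onsager_coef_pred onsager_coef_gt // mulr0 subr0.
Qed.

(** * The Onsager relations and the fixed points of the Chevalley involution *)

Section OnsagerPolynomial.
Variables (K : fieldType) (L : lieAlgType K) (x y : L) (a : int).

Definition onsager_poly (r : nat) : L :=
  \sum_(s < r.+1) (onsager_coef a r s)%:~R *: iter s (lieb x) y.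

Lemma onsager_poly0 : onsager_poly 0 = y.
Proof. by rewrite /onsager_poly big_ord_recl big_ord0 addr0 scale1r. Qed.

Lemma onsager_poly1 : onsager_poly 1 = [lie x, y].
Proof.
by rewrite /onsager_poly !big_ord_recl big_ord0 addr0 scale0r add0r scale1r.
Qed.

Lemma onsager_polySS r : onsager_poly r.+2 =
  [lie x, onsager_poly r.+1] - (r.+1%:Z * (r%:Z + a))%:~R *: onsager_poly r.
Proof.
pose c s := (onsager_coef a r s)%:~R *: iter s (lieb x) y.
have -> : onsager_poly r = \sum_(s < r.+3) c s.
  rewrite 2!big_ord_recr /= /c !onsager_coef_gt // !scale0r !addr0.
  by [].
rewrite lieb_sumr scaler_sumr -[X in _ = X - _]add0r.
have -> : 0 + \sum_(s < r.+2)
      [lie x, (onsager_coef a r.+1 s)%:~R *: iter s (lieb x) y]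
    = \sum_(s < r.+3) (if val s is s1.+1 then onsager_coef a r.+1 s1 else 0)%:~R
        *: iter s (lieb x) y.
  rewrite [RHS]big_ord_recl /= scale0r; congr (_ + _).
  by apply: eq_bigr => s _; rewrite liebZr.
rewrite -sumrB; apply: eq_bigr => s _.
by rewrite onsager_coef_recS ?leq_ord // intrB scalerBl intrM scalerA.
Qed.

End OnsagerPolynomial.

Lemma lie_eval_onsager_term (K : fieldType) n (A : 'M[int]_n) (L : lieAlgType K)
    (b : 'I_n -> L) i j :
  lie_eval b (onsager_term K A i j)
  = onsager_poly (b i) (b j) (A i j) (serre_exp A i j).
Proof.
rewrite /onsager_term (big_morph (lie_eval b) (id1 := 0) (op1 := +%R)) //.
apply: eq_bigr => s _ /=; congr (_ *: _).
by elim: (nat_of_ord s) => //= m ->.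
Qed.

Section FixedPoints.
Variables (K : fieldType) (n : nat) (A : 'M[int]_n) (rz : realization K A).
Hypothesis charK : [pchar K] =i pred0.
Hypothesis cartanA : gen_cartan_matrix A.

Local Notation g := (kac_moody rz).
Local Notation e := (km_e rz).
Local Notation f := (km_f rz).
Local Notation omega := (@chevalley K n A rz).
Local Notation Y i := (e i - f i).

Let omegaL : linear omega. Proof. exact: lie_hom_linear (chevalley_hom rz). Qed.
Let omegaB x y : omega [lie x, y] = [lie omega x, omega y].
Proof. exact: lie_hom_lieb (chevalley_hom rz) x y. Qed.

Definition chevalley_sym (x : g) : g := x + omega x.
Local Notation sym := chevalley_sym.

Lemma chevalley_sym_linear : linear sym.
Proof. by move=> a x y; rewrite /sym omegaL scalerDr addrACA. Qed.

Lemma chevalley_sym_h y : sym (km_h y) = 0.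
Proof. by rewrite /sym chevalley_h subrr. Qed.

Lemma chevalley_sym_omega x : sym (omega x) = sym x.
Proof. by rewrite /sym chevalley_involutive addrC. Qed.

Lemma chevalley_sym_e i : sym (e i) = Y i.
Proof. by rewrite /sym chevalley_e. Qed.

(** Y_i is fixed by omega, so ad Y_i commutes with [sym]. *)
Lemma lieb_Y_sym i x : [lie Y i, sym x] = sym [lie e i, x] - sym [lie f i, x].
Proof.
rewrite /sym !omegaB chevalley_e chevalley_f liebBl !liebDr !liebNl.
by rewrite !opprD !opprK !addrA [LHS](ACl (1*4*3*2))%AC.
Qed.

(** In [Y_i, sym (E m.+1)] the f_i-part is evaluated by [f_string] and cancels the second term of
    the recursion [onsager_polySS], leaving sym (E m.+2). *)
Lemma km_onsager_relation i j : i != j ->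
  onsager_poly (Y i) (Y j) (A i j) (serre_exp A i j) = 0.
Proof.
move=> ij; have symL := chevalley_sym_linear.
pose E m := iter m (lieb (e i)) (e j).
suff PE m : onsager_poly (Y i) (Y j) (A i j) m = sym (E m).
  by rewrite PE /E km_serre_e // (lin0 symL).
(* The recursion has order two, so the induction carries two consecutive indices. *)
have [] : onsager_poly (Y i) (Y j) (A i j) m = sym (E m) /\
    onsager_poly (Y i) (Y j) (A i j) m.+1 = sym (E m.+1); last by [].
elim: m => [|m [IH0 IH1]].
  rewrite onsager_poly0 onsager_poly1 -(chevalley_sym_e j) lieb_Y_sym.
  split=> //; rewrite [X in _ - X](_ : _ = 0) ?subr0 //.
  by rewrite liebC km_ef eq_sym (negbTE ij) oppr0 (lin0 symL).
split=> //; rewrite onsager_polySS IH0 IH1 lieb_Y_sym.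
have -> : [lie f i, E m.+1] = - (m.+1%:Z * (m%:Z + A i j))%:~R *: E m.
  apply: (@f_string _ _ _ _ e f (fun k => km_h (rz_coroot rz k))) => //.
  - by move=> a b; rewrite km_he rz_pairing.
  - exact: km_ef.
by rewrite (linZ symL) scaleNr opprK addrK.
Qed.

Lemma onsager_rel_Y t u : onsager_rel A t u ->
  lie_eval (km_Y rz) t = lie_eval (km_Y rz) u.
Proof.
case=> i j ij; rewrite lie_eval_onsager_term /=; apply: subalg_val_inj.
rewrite subalg_val0 -(km_onsager_relation ij) /onsager_poly.
elim/big_rec2: _ => [|s x y _ <-]; first by rewrite subalg_val0.
by rewrite subalg_valD subalg_valZ (lie_hom_iter _ _ _ (subalg_val_hom _)).
Qed.

Definition onsager_psi : onsager K A -> km_k rz :=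
  pres_lift (rel := onsager_rel A) (km_Y rz).

Lemma onsager_psi_hom : lie_hom onsager_psi.
Proof. exact: pres_lift_hom onsager_rel_Y. Qed.

Lemma onsager_psi_B i : onsager_psi (onsager_B K A i) = km_Y rz i.
Proof. exact: (pres_lift_gen onsager_rel_Y). Qed.

Lemma km_h_word x i s : exists c : K,
  [lie km_h x, lie_word e i s] = c *: lie_word e i s.
Proof.
elim: s i => [|j s IH] i /=; first by exists (rz_root rz i x); exact: km_he.
have [c wc] := IH j; exists ((rz_root rz i x : K) + c).
rewrite -[LHS](subrK [lie e i, [lie km_h x, lie_word e j s]]) -lieb_leibniz wc.
by rewrite km_he liebZl liebZr scalerDl.
Qed.

Lemma km_h_words x p : lspan (words e) p -> lspan (words e) [lie km_h x, p].
Proof.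
elim=> {p} [p [i [s ->]]||p q _ ? _ ?|a p _ ?].
- have [c ->] := km_h_word x i s; apply: lspanZ; apply: lspan_gen.
  by exists i, s.
- by rewrite lieb0r; exact: lspan0.
- by rewrite liebDr; exact: lspanD.
- by rewrite liebZr; exact: lspanZ.
Qed.

(** Each letter that f_k meets becomes an element of h(A), which scales the word or letter it is
    bracketed with; only a one-letter word contributes to [y]. *)
Lemma km_f_word k i s : exists y w,
  word_fil e (size s) w /\ [lie f k, lie_word e i s] = km_h y + w.
Proof.
have fe l : [lie f k, e l] = km_h (if k == l then - rz_coroot rz k else 0).
  rewrite liebC km_ef eq_sym; case: eqP => [->|_].
    by rewrite (linN (@km_h_linear _ _ _ rz)).
  by rewrite oppr0 (lin0 (@km_h_linear _ _ _ rz)).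
elim: s i => [|j s IH] i.
  by exists (if k == i then - rz_coroot rz k else 0), 0; rewrite addr0; split;
    [exact: (submod0 (word_fil e 0))|exact: fe].
have [y [w [ws E]]] := IH j; exists 0.
exists ([lie [lie f k, e i], lie_word e j s] + [lie e i, [lie f k, lie_word e j s]]).
split; last first.
  by rewrite (lin0 (@km_h_linear _ _ _ rz)) add0r lieb_leibniz subrK.
apply: submodD.
  rewrite fe; have [c ->] := km_h_word (if k == i then - rz_coroot rz k else 0) j s.
  by apply: submodZ; exact: word_fil_word.
rewrite E liebDr; apply: submodD; last exact: word_fil_lieb.
rewrite liebC km_he -scaleNr; apply: submodZ.
exact: (@word_fil_word _ _ _ e i [::]).
Qed.

Lemma km_f_fil k m p : word_fil e m.+1 p ->
  exists y w, word_fil e m w /\ [lie f k, p] = km_h y + w.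
Proof.
have hL := @km_h_linear _ _ _ rz.
elim=> {p} [p [i [s [sm ->]]]||p q _ [y [w [ww wE]]] _ [z [v [vv vE]]]|
    a p _ [y [w [ww wE]]]].
- have [y [w [ws ->]]] := km_f_word k i s; exists y, w; split=> //.
  by apply: word_fil_sub ws.
- by exists 0, 0; rewrite lieb0r (lin0 hL) addr0; split=> //; exact: submod0.
- exists (y + z), (w + v); rewrite liebDr (linD hL) addrACA wE vE.
  by split=> //; exact: submodD.
- exists (a *: y), (a *: w); rewrite liebZr (linZ hL) -scalerDr wE.
  by split=> //; exact: submodZ.
Qed.

Definition psi_image : set g := [set x | exists z, subalg_val (onsager_psi z) = x].

Lemma psi_imageL a x y : psi_image x -> psi_image y -> psi_image (a *: x + y).
Proof.
move=> [z <-] [w <-]; exists (a *: z + w).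
by rewrite (lie_hom_linear onsager_psi_hom) subalg_valD subalg_valZ.
Qed.

Lemma psi_image0 : psi_image 0.
Proof. by exists 0; rewrite (lin0 (lie_hom_linear onsager_psi_hom)) subalg_val0. Qed.

Lemma psi_image_Y i : psi_image (Y i).
Proof. by exists (onsager_B K A i); rewrite onsager_psi_B. Qed.

Lemma psi_imageB x y : psi_image x -> psi_image y -> psi_image [lie x, y].
Proof.
move=> [z <-] [w <-]; exists [lie z, w].
by rewrite (lie_hom_lieb onsager_psi_hom).
Qed.

(** By [lieb_Y_sym], sym [e_i, w] = [Y_i, sym w] + sym [f_i, w]; in the last term [sym] kills the
    Cartan part, and the rest is shorter. *)
Lemma psi_image_sym_fil m p : word_fil e m p -> psi_image (sym p).
Proof.
have symL := chevalley_sym_linear.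
elim: m p => [|m IH] p.
  elim=> {p} [p [i [s []]]||p q _ ? _ ?|a p _ ?] //.
  - by rewrite (lin0 symL); exact: psi_image0.
  - by rewrite -[p]scale1r symL; exact: psi_imageL.
  - by rewrite -[_ *: _]addr0 symL (lin0 symL); apply: psi_imageL => //; exact: psi_image0.
elim=> {p} [p [i [s [sm ->]]]||p q _ ? _ ?|a p _ ?] //.
- case: s sm => [|j s] /= sm; first by rewrite chevalley_sym_e; exact: psi_image_Y.
  rewrite -(subrK (sym [lie f i, lie_word e j s]) (sym _)) -lieb_Y_sym.
  rewrite -[[lie Y i, _]]scale1r; apply: psi_imageL.
    by apply: psi_imageB; [exact: psi_image_Y|apply/IH/word_fil_word].
  have [y [w [ws ->]]] := km_f_word i j s.
  rewrite (linD symL) chevalley_sym_h add0r; apply: IH; apply: word_fil_sub ws.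
  by rewrite ltnW.
- by rewrite (lin0 symL); exact: psi_image0.
- by rewrite -[p]scale1r symL; exact: psi_imageL.
- by rewrite -[_ *: _]addr0 symL (lin0 symL); apply: psi_imageL => //; exact: psi_image0.
Qed.

Definition triangular (x : g) : Prop := exists p y q,
  [/\ lspan (words e) p, lspan (words e) q & x = p + km_h y + omega q].

Lemma triangularL a x x' : triangular x -> triangular x' -> triangular (a *: x + x').
Proof.
move=> [p [y [q [pw qw ->]]]] [p' [y' [q' [pw' qw' ->]]]].
exists (a *: p + p'), (a *: y + y'), (a *: q + q').
split; [by apply: lspanD => //; apply: lspanZ..|].
by rewrite km_h_linear omegaL !scalerDr !addrA [LHS](ACl (1*4*2*5*3*6))%AC.
Qed.

Lemma triangular0 : triangular 0.
Proof.
exists 0, 0, 0; split; [exact: lspan0|exact: lspan0|].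
by rewrite (lin0 omegaL) (lin0 (@km_h_linear _ _ _ rz)) !addr0.
Qed.

Lemma triangularD x x' : triangular x -> triangular x' -> triangular (x + x').
Proof. by rewrite -{2}[x]scale1r; exact: triangularL. Qed.

Lemma triangularZ a x : triangular x -> triangular (a *: x).
Proof. by move=> tx; rewrite -[_ *: _]addr0; apply: triangularL => //; exact: triangular0. Qed.

Lemma triangular_words p : lspan (words e) p -> triangular p.
Proof.
move=> pw; exists p, 0, 0; split=> //; first exact: lspan0.
by rewrite (lin0 omegaL) (lin0 (@km_h_linear _ _ _ rz)) !addr0.
Qed.

Lemma triangular_h y : triangular (km_h y).
Proof.
by exists 0, y, 0; rewrite (lin0 omegaL) addr0 add0r; split=> //; exact: lspan0.
Qed.

Lemma triangular_omega x : triangular x -> triangular (omega x).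
Proof.
move=> [p [y [q [pw qw ->]]]]; exists q, (- y), p; split=> //.
rewrite !(linD omegaL) chevalley_involutive chevalley_h.
by rewrite (linN (@km_h_linear _ _ _ rz)) addrC (addrC (omega p)) addrA.
Qed.

(** The case of omega(q) is transported by omega: [e_i, omega q] = -omega [f_i, q], which [km_f_fil]
    handles. *)
Lemma triangular_lieb_e i x : triangular x -> triangular [lie e i, x].
Proof.
have ew k : lspan (words e) (e k) by apply: lspan_gen; exists k, [::].
move=> [p [y [q [pw qw ->]]]]; rewrite !liebDr; apply: triangularD; first apply: triangularD.
- have [m pm] := word_fil_exhaustive pw.
  by apply/triangular_words/word_fil_words/word_fil_lieb/pm.
- by rewrite liebC km_he -scaleNr; apply/triangularZ/triangular_words/ew.
have -> : [lie e i, omega q] = omega (- [lie f i, q]).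
  by rewrite (linN omegaL) omegaB chevalley_f liebNl opprK.
apply: triangular_omega; rewrite -scaleN1r; apply: triangularZ.
have [m qm] := word_fil_exhaustive qw.
have [z [w [wm ->]]] := km_f_fil i (word_fil_sub (leqnSn m) qm).
by apply: triangularD; [exact: triangular_h|exact/triangular_words/word_fil_words/wm].
Qed.

(** The sum n(A) + h(A) + omega(n(A)) contains the generators and is stable under bracketing with
    them, hence, by Leibniz, with every Lie term. *)
Lemma triangular_decomposition x : triangular x.
Proof.
have f_e i : f i = omega (- e i) by rewrite (linN omegaL) chevalley_e opprK.
have tf i y : triangular y -> triangular [lie f i, y].
  move=> ty; rewrite f_e -[y]chevalley_involutive -omegaB liebNl -scaleN1r.
  by apply/triangular_omega/triangularZ/triangular_lieb_e/triangular_omega.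
have tb t y : triangular y -> triangular [lie pres_pi (@km_rel _ _ _ rz) t, y].
  elim: t y => [[z|i|i]||t IHt u IHu|t IHt|a t IHt|t IHt u IHu] y ty.
  - case: ty => [p [w [q [pw qw ->]]]].
    rewrite -[pres_pi _ _]/(km_h z) !liebDr km_hh addr0; apply: triangularD.
      exact/triangular_words/km_h_words.
    rewrite -[km_h z]opprK -chevalley_h -(linN omegaL) -omegaB.
    apply/triangular_omega; rewrite liebNl -scaleN1r.
    exact/triangularZ/triangular_words/km_h_words.
  - exact: triangular_lieb_e.
  - exact: tf.
  - by rewrite pres_pi0 lieb0l; exact: triangular0.
  - by rewrite pres_piD liebDl; apply: triangularD; [exact: IHt|exact: IHu].
  - by rewrite pres_piN liebNl -scaleN1r; apply/triangularZ/IHt.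
  - by rewrite pres_piZ liebZl; apply/triangularZ/IHt.
  - rewrite pres_piB lieb_leibniz -scaleN1r addrC; apply: triangularL.
      exact/IHu/IHt.
    exact/IHt/IHu.
have te i : triangular (e i).
  by apply: triangular_words; apply: lspan_gen; exists i, [::].
elim/pres_ind: x; elim=> [[z|i|i]||t IHt u IHu|t IHt|a t IHt|t IHt u IHu].
- exact: triangular_h.
- exact: te.
- rewrite -[pres_pi _ _]/(f i) f_e -scaleN1r.
  exact/triangular_omega/triangularZ.
- exact: triangular0.
- by rewrite pres_piD; exact: triangularD.
- by rewrite pres_piN -scaleN1r; exact: triangularZ.
- by rewrite pres_piZ; exact: triangularZ.
- by rewrite pres_piB; exact: tb.
Qed.

Lemma psi_image_sym x : psi_image (sym x).
Proof.
have symL := chevalley_sym_linear.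
have im p : lspan (words e) p -> psi_image (sym p).
  by move=> /word_fil_exhaustive[m]; exact: psi_image_sym_fil.
have [p [y [q [pw qw ->]]]] := triangular_decomposition x.
rewrite !(linD symL) chevalley_sym_h addr0 chevalley_sym_omega.
by rewrite -[sym p]scale1r; apply: psi_imageL; exact: im.
Qed.

Lemma onsager_psi_surj x : exists z, onsager_psi z = x.
Proof.
have fx : omega (subalg_val x) = subalg_val x.
  by have /asboolP := subalg_valP x.
have n2 : 2%:R != 0 :> K by have /pcharf0P -> := charK.
have [z zE] := psi_image_sym (subalg_val x).
exists (2%:R^-1 *: z); apply: subalg_val_inj.
rewrite (linZ (lie_hom_linear onsager_psi_hom)) subalg_valZ zE /sym fx.
by rewrite -mulr2n -scaler_nat scalerA mulVf // scale1r.
Qed.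

(** * Leading terms of words in the Y_i *)

Section Leading.
Variable x0 : rz_h rz.
Hypothesis x0E : forall i, rz_root rz i x0 = 1 :> K.

Local Notation at_ := (@eigen_at _ _ (km_h x0)).
Local Notation below := (@eigen_below _ _ (km_h x0)).

Lemma km_e_eigen i : at_ 1 (e i).
Proof. by rewrite /eigen_at /= km_he x0E. Qed.

Lemma km_f_eigen i : at_ (-1) (f i).
Proof. by rewrite /eigen_at /= km_hf x0E. Qed.

Lemma km_word_eigen i s : at_ (size s).+1 (lie_word e i s).
Proof.
elim: s i => [|j s IH] i; first exact: km_e_eigen.
exact: (eigen_atB (km_e_eigen i) (IH j)).
Qed.

(** e_i raises the ad(x0)-eigenvalue by 1 and f_i lowers it by 1, so each choice of a letter f_i
    loses 2 from the top. *)
Lemma km_Y_word_leading i s :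
  below (size s).+1 (lie_word (fun k => Y k) i s - lie_word e i s).
Proof.
elim: s i => [|j s IH] i.
  rewrite addrAC subrr add0r; apply: submodN.
  exact: eigen_at_below (km_f_eigen i).
rewrite -[_ - _]/([lie Y i, lie_word (fun k => Y k) j s] - [lie e i, lie_word e j s]).
rewrite -(subrK [lie Y i, lie_word e j s] [lie Y i, _]) -liebBr -addrA.
apply: submodD; last first.
  rewrite liebBl addrAC subrr add0r; apply: submodN.
  by apply: eigen_at_below (eigen_atB (km_f_eigen i) (km_word_eigen j s)); rewrite /=; lia.
rewrite liebBl; apply: submodB.
  by apply: eigen_below_sub (eigen_belowB (km_e_eigen i) (IH j)); rewrite /=; lia.
by apply: eigen_below_sub (eigen_belowB (km_f_eigen i) (IH j)); rewrite /=; lia.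
Qed.

End Leading.

End FixedPoints.

(** * The degree derivation of an associated graded algebra *)

Section GradedDegree.
Variables (K : fieldType) (L : lieAlgType K) (F : lie_filtration L).
Local Notation G := (gr_type F).

Lemma gr_classL j a x y (Fx : F j x) (Fy : F j y) (Fxy : F j (a *: x + y)) :
  gr_class Fxy = a *: gr_class Fx + gr_class Fy :> G.
Proof.
apply: gr_ext => k; rewrite gr_funD gr_funZ /= /gr_class_fun.
by case: eqP => _; rewrite ?qpiD ?qpiZ // scaler0 addr0.
Qed.

Lemma gr_class_eq0 j x (Fx : F j x) : gr_class Fx = 0 :> G <-> F j.-1 x.
Proof.
split=> [/(congr1 (fun a : G => a j))|Fx'].
  by rewrite /= /gr_class_fun eqxx => /qpi_eq0.
apply: gr_ext => k /=; rewrite /gr_class_fun; case: eqP => [->|//].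
exact/qpi_eq0.
Qed.

Lemma gr_rep_class j x (Fx : F j x) :
  gr_rep (gr_class Fx : G) (fun k => if k == j then x else 0).
Proof.
move=> k; rewrite /= /gr_class_fun; case: eqP => [->|_] //.
by split; [exact: submod0|rewrite qpi0].
Qed.

Lemma gr_class_lieb i j x y (Fx : F i x) (Fy : F j y) :
  [lie gr_class Fx : G, gr_class Fy] = gr_class (fil_lieb Fx Fy).
Proof.
apply/gr_ext; apply: gr_rep_inj (gr_br_rep (gr_rep_class Fx) (gr_rep_class Fy)) _.
apply: gr_rep_ext (gr_rep_class (fil_lieb Fx Fy)) => k; rewrite /lie_conv.
have [->|kij] := eqVneq k (i + j)%N.
  have ilt : (i < (i + j).+1)%N by rewrite ltnS leq_addr.
  rewrite (bigD1 (Ordinal ilt)) //= eqxx addKn eqxx big1 ?addr0 // => l.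
  by rewrite -(inj_eq val_inj) /= => /negbTE ->; rewrite lieb0l.
rewrite big1 // => l _; case: eqP => [li|_]; last by rewrite lieb0l.
case: eqP => [kj|_]; last by rewrite lieb0r.
by move: kij; rewrite -kj li subnKC ?eqxx // -li -ltnS.
Qed.

Lemma gr_fun_at0 (a : G) : a 0%N = 0.
Proof.
have [x Fx ->] := gr_in_fil (gr_funP a) 0%N.
by rewrite (fil0 Fx) qpi0.
Qed.

Fact gr_deg_ok (a : G) : gr_ok (fun j => j%:R *: a j : quotmod (F j.-1)).
Proof.
case: (gr_funP a) => aF [N aN]; split.
  move=> j; have [x Fx ->] := aF j.
  by exists (j%:R *: x); [exact: submodZ|rewrite qpiZ].
by exists N => j /aN ->; rewrite scaler0.
Qed.

Definition gr_deg (a : G) : G := GrElt (gr_deg_ok a).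

Lemma gr_degE (a : G) j : gr_deg a j = j%:R *: a j.
Proof. by []. Qed.

Lemma gr_deg_linear : linear gr_deg.
Proof.
move=> c a b; apply: gr_ext => j.
by rewrite gr_funD gr_funZ !gr_degE gr_funD gr_funZ scalerDr !scalerA mulrC.
Qed.

Lemma gr_rep_deg (a : G) x : gr_rep a x -> gr_rep (gr_deg a) (fun j => j%:R *: x j).
Proof.
by move=> ax j; rewrite gr_degE; case: (ax j) => Fx ->; rewrite qpiZ; split=> //;
  exact: submodZ.
Qed.

Lemma gr_deg_deriv a b : gr_deg [lie a, b] = [lie gr_deg a, b] + [lie a, gr_deg b].
Proof.
have [x ax] := gr_rep_exists a; have [y by_] := gr_rep_exists b.
apply/gr_ext; apply: gr_rep_inj (gr_rep_deg (a := [lie a, b]) (gr_br_rep ax by_)) _.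
apply: gr_rep_ext; last first.
  apply: (@gr_repD _ _ F [lie gr_deg a, b] [lie a, gr_deg b]).
    exact: (gr_br_rep (gr_rep_deg ax) by_).
  exact: (gr_br_rep ax (gr_rep_deg by_)).
move=> k; rewrite -big_split scaler_sumr; apply: eq_bigr => i _ /=.
by rewrite liebZl liebZr -scalerDl -natrD subnKC // -ltnS; exact: ltn_ord.
Qed.

(** The component in degree 0 is zero, and every positive degree is invertible in characteristic
    zero. *)
Lemma gr_deg_inj : [pchar K] =i pred0 -> injective gr_deg.
Proof.
move=> charK; apply: linear_inj gr_deg_linear _ => a a0; apply: gr_ext => -[|j].
  exact: gr_fun_at0.
apply/eqP; have /eqP := congr1 (fun a : G => a j.+1) a0.
by rewrite gr_degE gr_fun0 scaler_eq0; have /pcharf0P -> := charK.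
Qed.

Lemma gr_deg_class1 x (Fx : F 1 x) : gr_deg (gr_class Fx) = gr_class Fx.
Proof.
apply: gr_ext => k; rewrite gr_degE /= /gr_class_fun.
by case: eqP => [->|_]; rewrite ?scale1r ?scaler0.
Qed.

Lemma gr_deg_eigen k (a : G) : [pchar K] =i pred0 ->
  gr_deg a = k%:R *: a -> gr_component k a.
Proof.
move=> /pcharf0P charK ak j jk; have /eqP := congr1 (fun a : G => a j) ak.
rewrite gr_degE gr_funZ -subr_eq0 -scalerBl scaler_eq0 => /predU1P[|/eqP //].
move=> /eqP; rewrite subr_eq0 => /eqP jkE; case/negP: jk.
have subK m l : (l <= m)%N -> (m%:R = l%:R :> K) -> (m <= l)%N.
  by move=> lm E; rewrite -subn_eq0 -(charK (m - l)%N) natrB // E subrr.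
case/orP: (leq_total j k) => le; rewrite eqn_leq le ?andbT /=.
  exact: subK.
exact: subK.
Qed.

End GradedDegree.

Lemma inj_surj_bijective (T U : Type) (f : T -> U) :
  injective f -> (forall y, exists x, f x = y) -> bijective f.
Proof.
move=> finj /choice[g fK]; exists g => // x; exact/finj/fK.
Qed.

(** * Symbols *)

Section Symbols.
Variables (K : fieldType) (n : nat) (A : 'M[int]_n) (rz : realization K A).
Hypothesis charK : [pchar K] =i pred0.
Hypothesis cartanA : gen_cartan_matrix A.

Local Notation F := (onsager_filtration K A).
Local Notation G := (onsager_gr K A).
Local Notation B := (onsager_B K A).
Local Notation b := (onsager_gr_B K A).
Local Notation e := (km_n_e rz).

Lemma onsager_wordE i s : onsager_word K A i s = lie_word B i s.
Proof. by elim: s i => //= j s IH i; rewrite IH. Qed.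

Lemma onsager_gr_iter i j m : exists Fx : F m.+1 (iter m (lieb (B i)) (B j)),
  iter m (lieb (b i)) (b j) = gr_class Fx.
Proof.
elim: m => [|m [Fx E]]; first by exists (onsager_fil_B K A j).
exists (onsager_fil_lieb (onsager_fil_B K A i) Fx).
by rewrite [LHS]/= E (gr_class_lieb (F := F)).
Qed.

(** The Onsager relation expresses its top term, of coefficient 1, through terms one filtration step
    lower. *)
Lemma onsager_gr_serre i j : i != j ->
  iter (serre_exp A i j) (lieb (b i)) (b j) = 0.
Proof.
move=> ij; have [Fx ->] := onsager_gr_iter i j (serre_exp A i j).
apply/gr_class_eq0; have := onsager_relation K A ij.
rewrite big_ord_recr /= onsager_coef_diag scale1r => /eqP.
rewrite addrC addr_eq0 => /eqP ->; apply: (submodN (W := onsager_fil K A (serre_exp A i j))).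
apply: (@submod_sum _ _ (onsager_fil K A (serre_exp A i j))) => s _.
apply: submodZ; have [Fs _] := onsager_gr_iter i j s.
exact: (onsager_fil_sub (ltn_ord s) Fs).
Qed.

Lemma onsager_gr_word i s : exists Fx : F (size s).+1 (onsager_word K A i s),
  lie_word b i s = gr_class Fx.
Proof.
elim: s i => [|j s IH] i; first by exists (onsager_fil_B K A i).
have [Fx E] := IH j; exists (onsager_fil_lieb (onsager_fil_B K A i) Fx).
by rewrite [LHS]/= E (gr_class_lieb (F := F)).
Qed.

Lemma km_n_words x : exists m, word_fil e m x.
Proof.
apply: word_fil_exhaustive; apply: generated_words.
elim/km_n_ind: x => [i||x y ? ?|a x ?|x y ? ?].
- by apply: lie_gen_gen; exists i.
- exact: lie_gen0.
- exact: lie_genD.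
- exact: lie_genZ.
- exact: lie_genB.
Qed.

Lemma km_n_word_val i s : subalg_val (lie_word e i s) = lie_word (km_e rz) i s.
Proof. exact: lie_word_hom (subalg_val_hom _). Qed.

Local Notation psi := (@onsager_psi K n A rz).

Variable x0 : rz_h rz.
Hypothesis x0E : forall i, rz_root rz i x0 = 1 :> K.

Local Notation at_ := (@eigen_at _ _ (km_h x0)).
Local Notation below := (@eigen_below _ _ (km_h x0)).

Variable phi : km_n rz -> G.
Hypothesis phi_hom : lie_hom phi.
Hypothesis phi_e : forall i, phi (e i) = b i.

Let phiL : linear phi. Proof. exact: lie_hom_linear phi_hom. Qed.
Let psiL : linear psi. Proof. exact: lie_hom_linear (onsager_psi_hom rz cartanA). Qed.

Lemma onsager_psi_word i s : subalg_val (psi (onsager_word K A i s))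
  = lie_word (fun k => km_e rz k - km_f rz k) i s.
Proof.
rewrite onsager_wordE (lie_word_hom _ _ _ (onsager_psi_hom rz cartanA)).
rewrite (lie_word_hom _ _ _ (subalg_val_hom _)); elim: s i => [|j s IH] i /=.
  by rewrite onsager_psi_B.
by rewrite IH onsager_psi_B.
Qed.

Lemma phi_word i s : phi (lie_word e i s) = lie_word b i s.
Proof.
rewrite (lie_word_hom _ _ _ phi_hom); elim: s i => [|j s IH] i /=.
  exact: phi_e.
by rewrite IH phi_e.
Qed.

Lemma km_n_span_eigen m y : word_span e m y -> at_ m (subalg_val y).
Proof.
rewrite /eigen_at /=; elim=> {y} [y [i [s [<- ->]]]||x y _ E _ E'|a y _ E].
- by rewrite km_n_word_val; exact: km_word_eigen.
- by rewrite subalg_val0 lieb0r scaler0.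
- by rewrite subalg_valD liebDr scalerDr E E'.
- by rewrite subalg_valZ liebZr E !scalerA mulrC.
Qed.

Lemma onsager_psi_fil j x : F j x -> below j.+1 (subalg_val (psi x)).
Proof.
elim=> {x} [x [i [s [sj ->]]]||x y _ ? _ ?|a x _ ?].
- rewrite onsager_psi_word -(subrK (lie_word (km_e rz) i s) (lie_word _ i s)).
  apply: submodD; last by apply: eigen_at_below (km_word_eigen x0E i s); rewrite ltz_nat.
  by apply: eigen_below_sub (km_Y_word_leading x0E i s); rewrite lez_nat ltnW.
- by rewrite (lin0 psiL) subalg_val0; exact: submod0.
- by rewrite (linD psiL) subalg_valD; exact: submodD.
- by rewrite (linZ psiL) subalg_valZ; exact: submodZ.
Qed.

(* [y] is the common leading part of degree [j] of [x], read both in the         *)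
(* principal grading of the Kac-Moody algebra and in the associated graded.      *)
Definition symbol (j : nat) (x : onsager K A) (y : km_n rz) : Prop :=
  exists Fx : F j x, [/\ word_span e j y,
    below j (subalg_val (psi x) - subalg_val y) & phi y = gr_class Fx].

Lemma symbolL j a x x' y y' :
  symbol j x y -> symbol j x' y' -> symbol j (a *: x + x') (a *: y + y').
Proof.
move=> [Fx [yj xy phiy]] [Fx' [yj' xy' phiy']].
exists (submodD (submodZ a Fx) Fx'); split.
- by apply: submodD => //; exact: submodZ.
- rewrite psiL !subalg_valD !subalg_valZ opprD addrACA -scalerBr.
  by apply: submodD => //; exact: submodZ.
- by rewrite phiL phiy phiy'; apply/esym/(gr_classL (F := F)).
Qed.

Lemma symbol_below j x : F j.-1 x -> F j x -> symbol j x 0.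
Proof.
move=> Fx' Fx; exists Fx; split; first exact: submod0.
  rewrite subalg_val0 subr0; case: j Fx' Fx => [|j] Fx' _.
    by rewrite (fil0 Fx') (lin0 psiL) subalg_val0; exact: submod0.
  exact: onsager_psi_fil.
by rewrite (lin0 phiL); apply/esym/gr_class_eq0.
Qed.

Lemma symbol_word i s : symbol (size s).+1 (onsager_word K A i s) (lie_word e i s).
Proof.
have [Fx E] := onsager_gr_word i s; exists Fx; split.
- by apply: lspan_gen; exists i, s.
- by rewrite onsager_psi_word km_n_word_val; exact: km_Y_word_leading.
- by rewrite phi_word.
Qed.

Lemma symbol0 j : symbol j 0 0.
Proof. by apply: symbol_below; exact: submod0. Qed.

Lemma symbol_total j x : F j x -> exists y, symbol j x y.
Proof.
elim=> {x} [x [i [s [sj ->]]]||x x' _ [y xy] _ [y' xy']|a x _ [y xy]].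
- move: sj; rewrite leq_eqVlt => /predU1P[<-|sj].
    by exists (lie_word e i s); exact: symbol_word.
  (* A word shorter than [j] already lies in the previous step, so its symbol in degree [j] is
     zero. *)
  have [Fx _] := onsager_gr_word i s; exists 0; apply: symbol_below.
    by apply: onsager_fil_sub Fx; rewrite -ltnS (leq_trans sj) // leqSpred.
  by apply: onsager_fil_sub Fx; exact: ltnW.
- by exists 0; exact: symbol0.
- by exists (1 *: y + y'); rewrite -[x]scale1r; exact: symbolL.
- by exists (a *: y + 0); rewrite -[a *: x]addr0; apply: symbolL => //; exact: symbol0.
Qed.

Lemma symbol_onto j y : word_span e j y -> exists x, symbol j x y.
Proof.
elim=> {y} [y [i [s [<- ->]]]||y y' _ [x xy] _ [x' xy']|a y _ [x xy]].
- by exists (onsager_word K A i s); exact: symbol_word.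
- by exists 0; exact: symbol0.
- by exists (1 *: x + x'); rewrite -[y]scale1r; exact: symbolL.
- by exists (a *: x + 0); rewrite -[a *: y]addr0; apply: symbolL => //; exact: symbol0.
Qed.

Lemma symbol_eq0 j x y : symbol j x y -> below j (subalg_val (psi x)) -> y = 0.
Proof.
move=> [Fx [yj xy _]] px; apply: subalg_val_inj; rewrite subalg_val0.
apply: (eigen_at_below0 charK (km_n_span_eigen yj)).
by rewrite -(subKr (subalg_val (psi x)) (subalg_val y)); exact: submodB.
Qed.

(** If psi x = 0 then the symbol of x vanishes, and applying phi to it shows that the class of x is
    zero: x descends through the filtration down to 0. *)
Lemma onsager_psi_inj : injective psi.
Proof.
apply: linear_inj psiL _ => x px; have [j Fx] := onsager_fil_exhaustive x.
elim: j Fx => [|j IH] Fx; first exact: onsager_fil0 Fx.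
apply: IH; have [y xy] := symbol_total Fx.
have y0 : y = 0 by apply: symbol_eq0 xy _; rewrite px subalg_val0; exact: submod0.
have [Fx' [_ _]] := xy; rewrite y0 (lin0 phiL) => /esym.
by move/(gr_class_eq0 (F := F)).
Qed.

Lemma phi_fil m y k : word_fil e m y -> (m < k)%N -> phi y k = 0.
Proof.
move=> ym mk; elim: ym => {y} [y [i [s [sm ->]]]||x y _ E _ E'|a y _ E].
- have [Fx] := onsager_gr_word i s; rewrite phi_word => ->.
  by rewrite /= /gr_class_fun gtn_eqF // (leq_ltn_trans sm).
- by rewrite (lin0 phiL).
- by rewrite (linD phiL) gr_funD E E' addr0.
- by rewrite (linZ phiL) gr_funZ E scaler0.
Qed.

Lemma word_fil_split m y : word_fil e m.+1 y ->
  exists u v, [/\ word_span e m.+1 u, word_fil e m v & y = u + v].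
Proof.
elim=> {y} [y [i [s [sm ->]]]||x y _ [u [v [um vm xE]]] _ [u' [v' [um' vm' yE]]]|
    a y _ [u [v [um vm ->]]]].
- move: sm; rewrite leq_eqVlt => /predU1P[sm|sm].
    exists (lie_word e i s), 0; rewrite addr0; split=> //; last exact: submod0.
    by apply: lspan_gen; exists i, s.
  exists 0, (lie_word e i s); rewrite add0r; split=> //; first exact: submod0.
  exact: word_fil_word.
- by exists 0, 0; rewrite addr0; split=> //; exact: submod0.
- exists (u + u'), (v + v'); rewrite xE yE addrACA.
  by split=> //; exact: submodD.
- exists (a *: u), (a *: v); rewrite scalerDr.
  by split=> //; exact: submodZ.
Qed.

(** In degree m+1 only the top part u contributes to phi y. If it vanishes, an x with symbol u lies
    one step lower, which bounds psi x and forces u = 0. *)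
Lemma phi_inj : injective phi.
Proof.
apply: linear_inj phiL _ => y; have [m] := km_n_words y.
elim: m y => [|m IH] y.
  move=> y0 _; elim: y0 => {y} [y [i [s []]]||x y _ -> _ ->|a y _ ->] //.
    by rewrite addr0.
  by rewrite scaler0.
move=> /word_fil_split[u [v [um vm ->]]] py.
have [x xu] := symbol_onto um; have [Fx [_ _ phiu]] := xu.
have Fx' : F m x.
  have := congr1 (fun a : G => a m.+1) py; rewrite (linD phiL) gr_funD.
  by rewrite (phi_fil vm) // addr0 phiu /= /gr_class_fun eqxx => /qpi_eq0.
have u0 : u = 0 by apply: symbol_eq0 xu _; exact: onsager_psi_fil.
by move: py; rewrite u0 add0r; exact: IH.
Qed.

(** The top component is the class of some x; subtracting phi of its symbol shrinks the support. *)
Lemma phi_surj a : exists y, phi y = a.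
Proof.
have [_ [N aN]] := gr_funP a.
elim: N a aN => [|N IH] a aN.
  by exists 0; rewrite (lin0 phiL); apply: gr_ext => j; rewrite aN.
have [x Fx ax] := gr_in_fil (gr_funP a) N.
have [y [Fx' [_ _ phiy]]] := symbol_total Fx.
have [j Nj|z zE] := IH (a - phi y); last first.
  by exists (z + y); rewrite (linD phiL) zE subrK.
rewrite -[LHS]/(a j - phi y j) phiy /= /gr_class_fun.
move: Nj; rewrite leq_eqVlt => /predU1P[<-|Nj].
  by rewrite eqxx ax subrr.
by rewrite gtn_eqF // subr0 aN.
Qed.

(** On a root space of height k, ad(x0) acts by k, and phi turns ad(x0) into the degree
    derivation. *)
Lemma phi_component k x : km_n_component k x -> gr_component k (phi x).
Proof.
move=> xk; apply: (gr_deg_eigen (F := F)) => //.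
apply: (km_n_hom_eigen (D := @gr_deg _ _ F) _ _ _ phi_hom phi_e x0E).
- exact: gr_deg_linear.
- exact: gr_deg_deriv.
- by move=> i; exact: gr_deg_class1.
elim: xk => {x} [y [beta [_ [c -> <-]] yb]||x y _ E _ E'|a y _ E].
- rewrite yb; congr (_ *: _); rewrite sum_lfunE natr_sum; apply: eq_bigr => i _.
  by rewrite -scaler_nat scale_lfunE x0E; exact: mulr1.
- by rewrite lieb0r scaler0.
- by rewrite liebDr scalerDr E E'.
- by rewrite liebZr E !scalerA mulrC.
Qed.

End Symbols.

Theorem theorem2p7 (R : realType) (n : nat) (A : 'M[int]_n)
    (rz : realization R[i] A)
    (hA : gen_cartan_matrix A) (hS : symmetrizable R[i] A) :
  (exists psi : onsager R[i] A -> km_k rz,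
     [/\ lie_hom psi,
         forall i : 'I_n, psi (onsager_B R[i] A i) = km_Y rz i,
         forall psi' : onsager R[i] A -> km_k rz, lie_hom psi' ->
           (forall i : 'I_n, psi' (onsager_B R[i] A i) = km_Y rz i) ->
           psi' =1 psi
       & bijective psi])
  /\
  (exists phi : km_n rz -> onsager_gr R[i] A,
     [/\ lie_hom phi,
         forall i : 'I_n, phi (km_n_e rz i) = onsager_gr_B R[i] A i,
         forall phi' : km_n rz -> onsager_gr R[i] A, lie_hom phi' ->
           (forall i : 'I_n, phi' (km_n_e rz i) = onsager_gr_B R[i] A i) ->
           phi' =1 phi,
         forall (k : nat) (x : km_n rz), km_n_component k x ->
           gr_component k (phi x)
       & bijective phi]).
Proof.
have charC : [pchar R[i]] =i pred0 by exact: pchar_num.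
have [x0 x0E] := realization_degree_element rz.
(* phi is constructed before psi is treated, because injectivity of psi relies on it. *)
have [||||phi phiH phi_e] := km_n_graded_hom rz hA
  (D := @gr_deg _ _ (onsager_filtration R[i] A)) (b := onsager_gr_B R[i] A).
- exact: gr_deg_linear.
- exact: gr_deg_inj.
- exact: gr_deg_deriv.
- exact: onsager_gr_serre.
split.
  exists (@onsager_psi _ _ _ rz); split.
  - exact: onsager_psi_hom.
  - exact: onsager_psi_B.
  - move=> psi' psiH psiB; exact: (pres_lift_unique (onsager_rel_Y rz hA)).
  - apply: inj_surj_bijective; last exact: onsager_psi_surj.
    exact: (onsager_psi_inj charC hA x0E phiH phi_e).
exists phi; split=> //.
- move=> phi' [phiL' phiB'] phi_e' x; have [phiL phiB] := phiH.
  elim/km_n_ind: x => [i||x y E E'|a x E|x y E E'].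
  + by rewrite phi_e phi_e'.
  + by rewrite (lin0 phiL) (lin0 phiL').
  + by rewrite (linD phiL) (linD phiL') E E'.
  + by rewrite (linZ phiL) (linZ phiL') E.
  + by rewrite phiB phiB' E E'.
- exact: (phi_component charC x0E).
- apply: inj_surj_bijective.
    exact: (phi_inj charC hA x0E phiH phi_e).
  exact: (phi_surj hA x0E phiH phi_e).
Qed.
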